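(* Let $\eta,\sigma>0$, fix $a=-(\eta/\sigma)$ and $b=+(\eta/\sigma)$, and let $X^+$ be the reflected Brownian motion on $[a,b]$ with $X^+_0$ uniformly distributed on $\{a,b\}$. Then, for each fixed $t\ge0$, $$\gamma^+_{r^+_t}(a)-\gamma^+_{r^+_t}(b)\ \stackrel{d}{=}\ Z^{\mathtt{tel}}_t\qquad\text{with } \alpha=1.$$
   Context: Reflected Brownian motion and local times. $X^+=\{X^+_t\}_{t\ge0}$ is the reflected Brownian motion on $[a,b]$ (generator $\varphi''$), satisfying the Skorokhod decomposition $$X^+_t=X^+_0+B_t+\gamma^+_t(a)-\gamma^+_t(b),$$ where $B$ is a Brownian motion with variance $2t$ and $\gamma^+_t(a)$, $\gamma^+_t(b)$ are the continuous non-decreasing boundary local times at $a$ and $b$ (started at $0$, increasing only when $X^+$ is at $a$, respectively at $b$). The total boundary local time is $\gamma^+_t=\gamma^+_t(a)+\gamma^+_t(b)$, and $r^+_t:=\inf\{s\ge0:\gamma^+_s>t\}$, so $\gamma^+_{r^+_t}=t$. The process $Z^{\mathtt{tel}}$ for $\alpha=1$. Let $\{\theta_j\}_{j\ge1}$ be i.i.d. with $\mathbf{P}(\theta_j=\pm1)=1/2$, independent of the i.i.d. sequence $\{e_j\}_{j\ge1}$ with $\mathbf{P}(e_j>t)=e^{-(\sigma/\eta)t}$, $t\ge 0$. Put $T_0=0$, $T_n=\sum_{j=1}^n e_j$, $N_t=\max\{n\ge0:T_n\le t\}$. For $\alpha=1$, $$Z^{\mathtt{tel}}_t=\sum_{j=1}^{N_t}\theta_j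 e_j+\theta_{1+N_t}\,(t-T_{N_t}).$$ *)

(* Defs.v *)
From HB Require Import structures.
From mathcomp Require Import all_boot all_order all_algebra.
From mathcomp Require Import all_classical all_reals all_analysis.

Set Implicit Arguments.
Unset Strict Implicit.
Unset Printing Implicit Defensive.

Import Order.TTheory GRing.Theory Num.Theory.
Import numFieldNormedType.Exports.

Local Open Scope classical_set_scope.
Local Open Scope ring_scope.

(* Time-indexed processes are functions R -> T -> R; only their values at
   nonnegative times are ever constrained or used. *)

Definition sigma_gen {d : measure_display} {T : measurableType d}
    {R : realType} {I : Type} (X : I -> T -> R) : set (set T) :=
  <<s \bigcup_i preimage_set_system setT (X i) measurable >>.

Definition indep_systems {d : measure_display} {T : measurableType d}
    {R : realType} (P : probability T R) (F G : set (set T)) : Prop :=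
  forall A B, F A -> G B -> P (A `&` B) = (P A * P B)%E.

Definition mutually_indep {d : measure_display} {T : measurableType d}
    {R : realType} (P : probability T R) {I : eqType} (X : I -> T -> R) : Prop :=
  forall (J : seq I) (A : I -> set R), uniq J ->
    (forall i, measurable (A i)) ->
    P (\bigcap_(i in [set` J]) X i @^-1` A i)
      = (\prod_(i <- J) P (X i @^-1` A i))%E.

(* Equality in law of two random variables which need only be defined, and
   measurable, up to null sets. For measurable X and Y this is the usual
   equality of the two image laws. *)
Definition eq_in_law {d d' : measure_display} {T : measurableType d}
    {T' : measurableType d'} {R : realType} (P : probability T R)
    (P' : probability T' R) (X : T -> R) (Y : T' -> R) : Prop :=
  exists (X' : {RV P >-> R}) (Y' : {RV P' >-> R}),
    [/\ {ae P, forall w, X w = X' w},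
        {ae P', forall w, Y w = Y' w} &
        forall A : set R, measurable A ->
          distribution P X' A = distribution P' Y' A].

Record is_filtration {d : measure_display} {T : measurableType d}
    {R : realType} (F : R -> set (set T)) : Prop := {
  filtration_sigma : forall t : R, 0 <= t -> sigma_algebra setT (F t) ;
  filtration_measurable : forall t : R, 0 <= t -> F t `<=` measurable ;
  filtration_mono : forall s t : R, 0 <= s -> s <= t -> F s `<=` F t }.

Definition adapted {d : measure_display} {T : measurableType d}
    {R : realType} (F : R -> set (set T)) (X : R -> T -> R) : Prop :=
  forall t : R, 0 <= t -> forall A : set R, measurable A -> F t (X t @^-1` A).

Definition continuous_path {R : realType} (x : R -> R) : Prop :=
  {within `[0, +oo[, continuous x}.

(* F-Brownian motion whose variance at time t is v * t;
   the second argument of normal_prob is the standard deviation. *)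
Record is_brownian {d : measure_display} {T : measurableType d}
    {R : realType} (P : probability T R) (F : R -> set (set T)) (v : R)
    (B : R -> T -> R) : Prop := {
  brownian_adapted : adapted F B ;
  brownian_start : {ae P, forall w, B 0 w = 0} ;
  brownian_continuous : {ae P, forall w, continuous_path (B^~ w)} ;
  brownian_increment : forall s t : R, 0 <= s -> s < t ->
    forall A : set R, measurable A ->
      P ((B t \- B s) @^-1` A) = normal_prob 0 (Num.sqrt (v * (t - s))) A ;
  brownian_indep : forall s t : R, 0 <= s -> s < t ->
    indep_systems P (F s) (preimage_set_system setT (B t \- B s) measurable) }.

(* l is a continuous non-decreasing path started at 0 which increases only
   when x is at the point c, i.e. it is constant on every time interval
   during which x avoids c. *)
Record is_boundary_local_time {R : realType} (x l : R -> R) (c : R) : Prop := {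
  local_time_start : l 0 = 0 ;
  local_time_continuous : continuous_path l ;
  local_time_mono : forall s t : R, 0 <= s -> s <= t -> l s <= l t ;
  local_time_support : forall s t : R, 0 <= s -> s <= t ->
    (forall u, s <= u <= t -> x u != c) -> l t = l s }.

Record skorokhod_path {R : realType} (a b : R) (x beta la lb : R -> R) : Prop := {
  skorokhod_range : forall t : R, 0 <= t -> a <= x t <= b ;
  skorokhod_decomp : forall t : R, 0 <= t -> x t = x 0 + beta t + la t - lb t ;
  skorokhod_left : is_boundary_local_time x la a ;
  skorokhod_right : is_boundary_local_time x lb b }.

(* Reflected Brownian motion on [a, b] with generator f |-> f'' (hence the
   factor 2 in the variance of the driving Brownian motion), given with its
   boundary local times ga at a and gb at b. *)
Record is_reflected_brownian {d : measure_display} {T : measurableType d}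
    {R : realType} (P : probability T R) (F : R -> set (set T)) (a b : R)
    (X B ga gb : R -> T -> R) : Prop := {
  reflected_filtration : is_filtration F ;
  reflected_brownian : is_brownian P F 2 B ;
  reflected_adapted : adapted F X ;
  reflected_adapted_left : adapted F ga ;
  reflected_adapted_right : adapted F gb ;
  reflected_skorokhod :
    {ae P, forall w,
      skorokhod_path a b (X^~ w) (B^~ w) (ga^~ w) (gb^~ w)} }.

(* Right-continuous inverse of g; almost surely finite when g is the total
   boundary local time. When g never exceeds t the value is inf set0 = 0. *)
Definition inverse_time {R : realType} (g : R -> R) (t : R) : R :=
  inf [set s | 0 <= s /\ t < g s].

(* Sequences are indexed from 0: theta i and e i stand for the (i+1)-st sign
   and the (i+1)-st waiting time. *)

Definition arrival_time {R : realType} (e : nat -> R) (n : nat) : R :=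
  \sum_(i < n) e i.

(* max {n | T_n <= t} with T_n = arrival_time e n; the default value 0
   is used only when this maximum does not exist, a null event for i.i.d. exponential waiting times. *)
Definition arrival_count {R : realType} (e : nat -> R) (t : R) : nat :=
  xget 0%N [set n | arrival_time e n <= t /\
                    forall m, arrival_time e m <= t -> (m <= n)%N].

Definition telegraph {R : realType} (theta e : nat -> R) (t : R) : R :=
  let N := arrival_count e t in
  \sum_(i < N) theta i * e i + theta N * (t - arrival_time e N).

Record is_telegraph_data {d : measure_display} {T : measurableType d}
    {R : realType} (P : probability T R) (rate : R)
    (theta e : nat -> {RV P >-> R}) : Prop := {
  telegraph_sign_pos : forall i, P [set w | theta i w = 1] = (1 / 2)%:E ;
  telegraph_sign_neg : forall i, P [set w | theta i w = -1] = (1 / 2)%:E ;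
  telegraph_sign_indep : mutually_indep P theta ;
  telegraph_wait_tail : forall i (t : R), 0 <= t ->
    P [set w | t < e i w] = (expR (- (rate * t)))%:E ;
  telegraph_wait_indep : mutually_indep P e ;
  telegraph_indep : indep_systems P (sigma_gen theta) (sigma_gen e) }.

(* Main.v *)
Require Import Defs.
From HB Require Import structures.
From mathcomp Require Import all_boot all_order all_algebra.
From mathcomp Require Import all_classical all_reals all_analysis.
From mathcomp Require Import measurable_realfun.
From mathcomp Require Import ring lra.

(** Both variables are bounded by [t], so their laws are determined by the
    moments of [exp (mu Z)] for [mu = 1, 2, ...].  Let [rate = sigma / eta] and let
    [y] be a root of [mu y^2 - rate y - mu = 0].  If [Xi] is the last sign
    [theta_(1+N_t)] on the telegraph side and [- X_(r_t) / b] on the other side,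
    then in both cases [E (exp (mu Z + mu y t) (1 - y Xi)) = 1], and the two roots
    give a linear system which determines [E (exp (mu Z))].
    For the telegraph process the identity is a martingale along the jumps.  For
    the reflected Brownian motion, with [gamma (a)] and [gamma (b)] the boundary
    local times, [exp (mu (gamma (a) - gamma (b)) + mu y (gamma (a) + gamma (b)))
    (1 + y X / b)] is a local martingale: it is linear in [X], and the choice of
    [y] cancels its boundary terms.  No stochastic calculus is needed: linearity
    in [X] means that Riemann sums with truncated increments of [B], stopped when
    the boundary clock passes [t], converge path by path. *)

Set Implicit Arguments.
Unset Strict Implicit.
Unset Printing Implicit Defensive.

Import Order.TTheory GRing.Theory Num.Theory.
Import numFieldNormedType.Exports.

Local Open Scope classical_set_scope.
Local Open Scope ring_scope.

(** * Bounded measurable functions and independence *)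

(** Read on the boundary clock [gamma (a) + gamma (b)], the difference [gamma (a) - gamma (b)] moves
    with slope 1 while [X] is at [a] and with slope -1 while [X] is at [b]; hence [- X / b] is its
    velocity and corresponds to the current sign of the telegraph process. The quadratic equation
    arises on both sides. A weight [exp (p gamma (a) + q gamma (b)) (1 + c X)] has no boundary terms
    when [p (1 + c a) + c = 0] and [q (1 + c b) = c]; for [p = mu y + mu], [q = mu y - mu],
    [c = y / b] and [a = - b] these are one and the same equation. For the telegraph process it
    comes from integrating out one exponential waiting time, the square of a sign being 1. The two
    roots have product -1, so they are distinct. The obstacle is the exchange of limit and
    expectation: [r_t] is unbounded and the Riemann sums have no common bound. The sums are
    therefore taken up to a fixed horizon [L], where their second moments are bounded independently
    of the mesh; then [L] tends to infinity, and the weight stays bounded because the clock never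
    exceeds [t]. Almost sure limits need not be measurable, so measurable versions replace them. *)

Definition bounded_measurable {d} {T : measurableType d} {R : realType}
    (f : T -> R) :=
  measurable_fun setT f /\ exists K, forall x, `|f x| <= K.

Section bounded_measurable_theory.
Context {d} {T : measurableType d} {R : realType}.
Implicit Types f g : T -> R.

Lemma bounded_measurable_cst (k : R) :
  bounded_measurable (fun _ : T => k).
Proof. by split; [exact: measurable_cst|exists `|k|]. Qed.

Lemma bounded_measurableD f g : bounded_measurable f ->
  bounded_measurable g -> bounded_measurable (fun x => f x + g x).
Proof.
move=> [mf [K fK]] [mg [L gL]]; split; first exact: measurable_funD.
exists (K + L) => x; apply: (le_trans (ler_normD _ _)); exact: lerD.
Qed.

Lemma bounded_measurableM f g : bounded_measurable f ->
  bounded_measurable g -> bounded_measurable (fun x => f x * g x).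
Proof.
move=> [mf [K fK]] [mg [L gL]]; split; first exact: measurable_funM.
by exists (K * L) => x; rewrite normrM ler_pM.
Qed.

Lemma bounded_measurableN f : bounded_measurable f ->
  bounded_measurable (fun x => - f x).
Proof.
move=> [mf [K fK]]; split; first exact: measurableT_comp.
by exists K => x; rewrite normrN.
Qed.

Lemma bounded_measurableB f g : bounded_measurable f ->
  bounded_measurable g -> bounded_measurable (fun x => f x - g x).
Proof.
by move=> bf bg; exact/bounded_measurableD/bounded_measurableN.
Qed.

Lemma bounded_measurable_indic (A : set T) : measurable A ->
  bounded_measurable (\1_A : T -> R).
Proof.
move=> mA; split; first exact: measurable_indic.
by exists 1 => x; rewrite indicE; case: (_ \in _); rewrite ?normr1 ?normr0.
Qed.

Lemma bounded_measurable_sum (I : Type) (s : seq I) (F : I -> T -> R) :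
  (forall i, bounded_measurable (F i)) ->
  bounded_measurable (fun x => \sum_(i <- s) F i x).
Proof.
move=> bF; elim: s => [|i s IH].
  under eq_fun do rewrite big_nil; exact: bounded_measurable_cst.
under eq_fun do rewrite big_cons; exact: bounded_measurableD.
Qed.

Lemma bounded_measurable_comp d' (U : measurableType d') (h : U -> T) f :
  measurable_fun setT h -> bounded_measurable f -> bounded_measurable (f \o h).
Proof.
move=> mh [mf [K fK]]; split; first exact: measurableT_comp.
by exists K => x /=.
Qed.

Variable mu : {finite_measure set T -> \bar R}.

Lemma bounded_measurable_integrable f :
  bounded_measurable f -> mu.-integrable setT (EFin \o f).
Proof.
move=> [mf [K fK]]; apply: measurable_bounded_integrable => //.
  by rewrite -ge0_fin_numE// fin_num_measure.
exists K; split; first exact: num_real.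
by move=> M KM x _; exact: le_trans (fK x) (ltW KM).
Qed.

Lemma Rintegral_bounded_fin f : bounded_measurable f ->
  (\int[mu]_x (f x)%:E)%E = (\int[mu]_x f x)%:E.
Proof.
move=> bf; rewrite /Rintegral fineK//.
by apply: integrable_fin_num => //; exact: bounded_measurable_integrable.
Qed.

Lemma le_norm_Rintegral f g : bounded_measurable f -> bounded_measurable g ->
  (forall x, `|f x| <= g x) -> `|\int[mu]_x f x| <= \int[mu]_x g x.
Proof.
move=> bf bg fg; rewrite ler_norml; apply/andP; split.
  rewrite lerNl -[leLHS]mulN1r -RintegralZl//; last exact: bounded_measurable_integrable.
  apply: le_Rintegral => //; do 1?exact: bounded_measurable_integrable.
    apply: bounded_measurable_integrable.
    by apply: bounded_measurableM => //; exact: bounded_measurable_cst.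
  by move=> x _; have := fg x; rewrite ler_norml; lra.
apply: le_Rintegral => //; do 1?exact: bounded_measurable_integrable.
by move=> x _; exact: le_trans (ler_norm _) (fg x).
Qed.

Lemma bounded_convergence (f_ : nat -> T -> R) f (K : R) :
  (forall n, measurable_fun setT (f_ n)) -> measurable_fun setT f ->
  (forall n x, `|f_ n x| <= K) ->
  {ae mu, forall x, f_ n x @[n --> \oo] --> f x} ->
  (\int[mu]_x f_ n x) @[n --> \oo] --> \int[mu]_x f x.
Proof.
move=> mf_ mf f_K f_f.
have [] := @dominated_convergence _ _ _ mu setT measurableT
  (fun n x => (f_ n x)%:E) (EFin \o f) (cst K%:E).
- by move=> n; exact/measurable_EFinP.
- exact/measurable_EFinP.
- apply: filterS f_f => x h _; apply: cvg_EFin => /=; [exact: nearW|exact: h].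
- by apply: bounded_measurable_integrable; exact: bounded_measurable_cst.
- by apply: aeW => x n _ /=; rewrite lee_fin.
move=> ifin _ cv; apply: fine_cvg.
by rewrite fineK//; exact: integrable_fin_num.
Qed.

End bounded_measurable_theory.

Lemma Rintegral_prob_cst {d} {T : measurableType d} {R : realType}
  (P : probability T R) (k : R) : \int[P]_x k = k.
Proof. by rewrite Rintegral_cst// [X in fine X]probability_setT mulr1. Qed.

Lemma Rintegral_distribution {d d'} {T : measurableType d}
  {U : measurableType d'} {R : realType} (P : probability T R)
  (X : {RV P >-> U}) (f : U -> R) : bounded_measurable f ->
  \int[distribution P X]_y f y = \int[P]_x f (X x).
Proof.
move=> bf; congr fine; rewrite integral_distribution//.
  by apply/measurable_EFinP; case: bf.
apply: (@bounded_measurable_integrable _ _ _ P (f \o X)).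
exact: bounded_measurable_comp.
Qed.

(** A sub-sigma-algebra is handled as a type: [g_sigma_algebraType G] has the points of [T] but only
    the measurable sets generated by [G]. A function annotated with this domain is measurable with
    respect to the past, and the lemma forgets that information. *)
Lemma measurable_fun_g_sigma_algebra {d d'} {T : measurableType d}
    {U : measurableType d'} (G : set (set T)) (f : T -> U) :
  G `<=` measurable ->
  measurable_fun setT (f : g_sigma_algebraType G -> U) ->
  measurable_fun setT f.
Proof.
move=> Gm mf _ B mB; rewrite setTI.
have := mf measurableT B mB; rewrite setTI.
apply: smallest_sub => //; exact: sigma_algebra_measurable.
Qed.

Lemma bounded_measurable_g_sigma_algebra {d} {T : measurableType d} {R : realType}
    (G : set (set T)) (f : T -> R) :
  G `<=` measurable ->
  bounded_measurable (f : g_sigma_algebraType G -> R) -> bounded_measurable f.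
Proof.
by move=> Gm [mf bf]; split => //; exact: measurable_fun_g_sigma_algebra mf.
Qed.

(** * Conditioning on an independent sigma-algebra through Fubini *)

Section freezing.
Context {d d'} {T : measurableType d} {U : measurableType d'} {R : realType}.
Variable P : probability T R.
Variables (G : set (set T)) (W : {RV P >-> U}).
Hypothesis Gm : G `<=` measurable.
Hypothesis GI : setI_closed G.
Hypothesis GT : G setT.
Hypothesis G_indep : indep_systems P G (preimage_set_system setT W measurable).

Local Notation TG := (g_sigma_algebraType G).

(** For fixed [B] both sides are finite measures in [A]. They agree on [G], which is stable under
    intersection and contains the whole space, hence on the sigma-algebra generated by [G]. *)
Lemma indep_g_sigma_algebra (A : set T) (B : set U) : <<s G >> A ->
  measurable B -> P (A `&` W @^-1` B) = (P A * P (W @^-1` B))%E.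
Proof.
move=> GA mB.
have mWB : measurable (W @^-1` B) by exact: measurable_funPTI.
pose k : {nonneg R} := NngNum (fine_ge0 (measure_ge0 P (W @^-1` B))).
have kE : (k%:num%:E)%R = P (W @^-1` B) by rewrite /= fineK// fin_num_measure.
transitivity (mrestr P mWB A) => //.
transitivity (mscale k P A); last by rewrite /mscale /= -kE muleC.
apply: (g_sigma_algebra_measure_unique G Gm (fun=> setT)) => //.
- by rewrite bigcup_const.
- move=> C GC; transitivity (P (W @^-1` B) * P C)%E; last by rewrite -kE.
  rewrite muleC; apply: G_indep => //; exists B => //; by rewrite setTI.
- by move=> _; rewrite /mrestr -ge0_fin_numE// fin_num_measure//; exact: measurableI.
Qed.

(** The identity, seen as a random variable with values in the coarser space. Its law is the
    restriction of [P] to the sigma-algebra generated by [G], and independence says that its joint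
    law with [W] is a product measure. *)
Let idG (w : T) : TG := w.
Let m_idG : measurable_fun setT idG.
Proof.
move=> _ B mB; rewrite setTI.
move: B mB; apply: smallest_sub => //; exact: sigma_algebra_measurable.
Qed.
HB.instance Definition _ := isMeasurableFun.Build _ _ T TG idG m_idG.

Let pairG (w : T) : TG * U := (idG w, W w).
Let m_pairG : measurable_fun setT pairG.
Proof. by apply: measurable_fun_pair => //. Qed.
HB.instance Definition _ := isMeasurableFun.Build _ _ T (TG * U)%type pairG m_pairG.

(* [G] is independent of [W], so in an expectation over [W] the variables that
   are measurable for the sigma-algebra generated by [G] can be frozen. *)
Lemma freezing (f : TG * U -> R) : bounded_measurable f ->
  \int[P]_w f (w, W w) = \int[P]_w \int[distribution P W]_v f (w, v).
Proof.
move=> bf.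
transitivity (\int[distribution P pairG]_z f z).
  by rewrite Rintegral_distribution.
transitivity (\int[(distribution P idG \x distribution P W)%E]_z f z).
  congr fine; apply: eq_measure_integral => /= C mC _.
  apply/esym/product_measure_unique => // A B mA mB.
  rewrite /distribution /pushforward /=.
  by rewrite -indep_g_sigma_algebra.
have intf : (distribution P idG \x distribution P W)%E.-integrable setT (EFin \o f).
  have [mf [K fK]] := bf; apply: measurable_bounded_integrable => //.
    have e : (distribution P idG \x distribution P W)%E (setT `*` setT) = 1%E.
      rewrite product_measure1E//; transitivity (P setT * P setT)%E => //.
      by rewrite probability_setT mule1.
    by rewrite -setXTT; apply: eq_ind_r (fun x => (x < +oo)%E) _ _ e; rewrite ltry.
  exists K; split; first exact: num_real.
  by move=> M KM x _; exact: le_trans (fK x) (ltW KM).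
rewrite {1}/Rintegral -integral12_prod_meas1//.
have bfw w : bounded_measurable (fun v => f (w, v)).
  apply: (@bounded_measurable_comp _ _ _ _ _ (fun v : U => (w, v) : TG * U)) => //.
  by apply: measurable_fun_pair.
rewrite /fubini_F; under eq_integral do rewrite /= Rintegral_bounded_fin//.
rewrite -/(Rintegral _ _ _).
rewrite Rintegral_distribution//.
have [mf [K fK]] := bf.
split.
  apply/measurable_EFinP.
  have := measurable_fubini_F intf; rewrite /fubini_F.
  by under eq_fun do rewrite /= Rintegral_bounded_fin//.
exists K => w; apply: le_trans; first apply: (@le_norm_Rintegral _ _ _ _ _ (fun=> K)) => //.
- exact: bounded_measurable_cst.
- by rewrite Rintegral_prob_cst.
Qed.

End freezing.

(** * Almost sure limits and exponential moments *)

Definition mfun_of {d d'} {T : measurableType d} {U : measurableType d'}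
    (f : T -> U) (mf : measurable_fun setT f) : {mfun T >-> U} :=
  HB.pack f (isMeasurableFun.Build _ _ _ _ f mf).

(** The limit [x] is only controlled off a null set and may fail to be measurable there; replacing
    it by 0 on a measurable null set makes it an everywhere limit of measurable functions. *)
Lemma ae_limit_version {d} {T : measurableType d} {R : realType}
    (P : probability T R) (u : nat -> T -> R) (x : T -> R) :
  (forall n, measurable_fun setT (u n)) ->
  {ae P, forall w, u n w @[n --> \oo] --> x w} ->
  exists X : {RV P >-> R}, {ae P, forall w, x w = X w}.
Proof.
move=> mu [N [mN N0 subN]].
pose y w := x w * \1_(~` N) w.
have my : measurable_fun setT y.
  apply: (@measurable_fun_cvg _ _ _ _ (fun n w => u n w * \1_(~` N) w)) => //.
    move=> n; apply: measurable_funM => //.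
    by apply: measurable_indic; exact: measurableC.
  move=> w _; rewrite /y; have [Nw|Nw] := pselect (N w).
    rewrite indicE memNset ?mulr0; last by move=> /(_ Nw).
    by under eq_fun do rewrite mulr0; exact: cvg_cst.
  apply: cvgM; last exact: cvg_cst.
  by apply: contrapT => h; apply: Nw; exact: subN.
exists (mfun_of my); exists N; split => // w /= xy.
apply: contrapT => Nw; apply: xy; rewrite /y indicE mem_set ?mulr1//.
Qed.

Lemma cvg_expRN_harmonic {R : realType} (f : nat -> R) :
  (forall n, 0 <= f n) -> (\forall n \near \oo, f n <= expR (- n%:R)) ->
  f n @[n --> \oo] --> 0.
Proof.
move=> f0 fn.
apply: (@squeeze_cvgr _ _ _ _ (cst 0) (@harmonic R)); last 2 first.
- exact: cvg_cst.
- exact: cvg_harmonic.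
near=> n; rewrite f0 /=; apply: (@le_trans _ _ (expR (- n%:R))).
  by near: n.
rewrite expRN lef_pV2 ?posrE ?expR_gt0 ?ltr0Sn//.
by rewrite -natr1 addrC expR_ge1Dx.
Unshelve. all: by end_near. Qed.

(* A family of bounded functions of [exp (n v)] which approximates the indicator
   function of a half-line. *)
Lemma cvg_double_expR {R : realType} (x : R) :
  expR (- expR ((n * n)%:R * x + n%:R)) @[n --> \oo] --> ((x < 0)%R%:R : R).
Proof.
(* The shift [n%:R] settles the case [x = 0], where the quadratic term alone would leave the
   constant [expR (-1)]. *)
have [x0|x0] /= := ltP x 0; last first.
  apply: cvg_expRN_harmonic => [n|]; first exact: expR_ge0.
  near=> n; rewrite ler_expR lerN2.
  have : 0 <= (n * n)%:R * x by rewrite mulr_ge0.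
  by have := expR_ge1Dx ((n * n)%:R * x + n%:R); lra.
rewrite -[X in _ --> X](subr0 1); apply: (@cvg_trans _ 
  (1 - (1 - expR (- expR ((n * n)%:R * x + n%:R))) @[n --> \oo])).
  by apply: near_eq_cvg; near=> n; lra.
apply: cvgB; first exact: cvg_cst.
apply: cvg_expRN_harmonic => [n|].
  by rewrite subr_ge0 -expR0 ler_expR oppr_le0 expR_ge0.
near=> n.
(* As soon as [n] is at least [2 / - x], the quadratic term is at most [- 2 n] and outweighs the
   shift. *)
have nx : 2 <= n%:R * - x.
  rewrite -ler_pdivrMr ?oppr_gt0//.
  by near: n; exact: nbhs_infty_ger.
have h : (n * n)%:R * x + n%:R <= - n%:R.
  rewrite natrM -mulrA; have : n%:R * (n%:R * - x) >= n%:R * (2 : R).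
    by rewrite ler_wpM2l.
  by rewrite mulrN mulrN; lra.
have := expR_ge1Dx (- expR ((n * n)%:R * x + n%:R)).
have : expR ((n * n)%:R * x + n%:R) <= expR (- n%:R) by rewrite ler_expR.
by lra.
Unshelve. all: by end_near. Qed.

(** * Integer exponential moments determine a bounded law *)

Section exponential_moments.
Context {d d'} {T : measurableType d} {T' : measurableType d'} {R : realType}.
Variables (P : probability T R) (P' : probability T' R).
Variables (X : {RV P >-> R}) (Y : {RV P' >-> R}) (K : R).
Hypothesis XK : forall w, `|X w| <= K.
Hypothesis YK : forall w, `|Y w| <= K.
Hypothesis moments : forall n : nat,
  \int[P]_w expR (n%:R * X w) = \int[P']_w expR (n%:R * Y w).

(** Taylor sums of [expR (- expR (n%:R * v + a))] in powers of the inner exponential. Each term is a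
    multiple of [expR ((n * k)%:R * v)], whose expectation is one of the given moments, and the
    bound [K] makes the sums uniformly bounded, so that the series can be integrated term by
    term. *)
Let partial (n : nat) (a : R) (m : nat) (v : R) : R :=
  \sum_(0 <= k < m) ((- expR a) ^+ k / k`!%:R) * expR ((n * k)%:R * v).

Let partialE n a m v :
  partial n a m v = series (exp_coeff (- expR (n%:R * v + a))) m.
Proof.
rewrite /partial /series /=; apply: eq_bigr => k _.
have -> : - expR (n%:R * v + a) = expR (n%:R * v) * - expR a by rewrite expRD mulrN.
rewrite /exp_coeff /= exprMn -expRM_natl natrM -[RHS]mulrA [RHS]mulrC.
by congr (_ * expR _); ring.
Qed.

Let partial_le n a m v : `|partial n a m v| <= expR (expR (n%:R * v + a)).
Proof.
rewrite partialE; set y := - expR _.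
have -> : expR (n%:R * v + a) = `|y| by rewrite normrN ger0_norm// expR_ge0.
apply: (@le_trans _ _ (series (exp_coeff `|y|) m)).
  rewrite /series /=; apply: (le_trans (ler_norm_sum _ _ _)).
  apply: ler_sum => k _.
  by rewrite /exp_coeff /= normrM normrX [X in _ * X]ger0_norm ?invr_ge0 ?ler0n.
apply: nondecreasing_cvgn_le; last exact: is_cvg_series_exp_coeff.
apply/nondecreasing_seqP => k; rewrite /series /= big_nat_recr //= lerDl.
exact: exp_coeff_ge0.
Qed.

Let partial_bound n a m v : `|v| <= K -> `|partial n a m v| <= expR (expR (n%:R * K + a)).
Proof.
move=> vK; apply: (le_trans (partial_le _ _ _ _)).
rewrite !ler_expR lerD2r ler_wpM2l//; exact: le_trans (ler_norm _) vK.
Qed.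

Let bounded_expR d0 (T0 : measurableType d0) (Z : T0 -> R) (a b : R) :
  measurable_fun setT Z -> (forall w, `|Z w| <= K) ->
  bounded_measurable (fun w => expR (a * Z w + b)).
Proof.
move=> mZ ZK; split.
  apply: measurableT_comp => //; apply: measurable_funD => //.
  exact: measurable_funM.
exists (expR (`|a| * K + b)) => w; rewrite ger0_norm ?expR_ge0// ler_expR.
rewrite lerD2r (le_trans (ler_norm _))// normrM ler_wpM2l//.
Qed.

Let Rintegral_partial d0 (T0 : measurableType d0) (Q : probability T0 R)
    (Z : {RV Q >-> R}) n a m : (forall w, `|Z w| <= K) ->
  \int[Q]_w partial n a m (Z w) = \sum_(0 <= k < m) ((- expR a) ^+ k / k`!%:R) *
     \int[Q]_w expR ((n * k)%:R * Z w).
Proof.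
move=> ZK.
have be k : bounded_measurable (fun w => expR ((n * k)%:R * Z w)).
  have := @bounded_expR _ _ Z (n * k)%:R 0 (measurable_funPT Z) ZK.
  by under eq_fun do rewrite addr0.
elim: m => [|m IH].
  by under eq_Rintegral do rewrite /partial big_geq//; rewrite Rintegral_prob_cst big_geq.
under eq_Rintegral do rewrite /partial big_nat_recr//=.
rewrite RintegralD//; first last.
- apply: bounded_measurable_integrable.
  by apply: bounded_measurableM => //; exact: bounded_measurable_cst.
- apply: (bounded_measurable_integrable Q).
  apply: bounded_measurable_sum => k.
  by apply: bounded_measurableM => //; exact: bounded_measurable_cst.
rewrite big_nat_recr//= -/(partial _ _ _ _) IH; congr (_ + _).
by rewrite RintegralZl//; exact: bounded_measurable_integrable.
Qed.

Let Rintegral_double_expR_aux d0 (T0 : measurableType d0) (Q : probability T0 R)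
    (Z : {RV Q >-> R}) n a : (forall w, `|Z w| <= K) ->
  \sum_(0 <= k < m) ((- expR a) ^+ k / k`!%:R) *
     \int[Q]_w expR ((n * k)%:R * Z w) @[m --> \oo] -->
  \int[Q]_w expR (- expR (n%:R * Z w + a)).
Proof.
move=> ZK; under eq_fun do rewrite -Rintegral_partial//.
have me : measurable_fun setT (fun w => expR (- expR (n%:R * Z w + a))).
  do 3 apply: measurableT_comp => //; apply: measurable_funD => //.
  exact: measurable_funM.
apply: (@bounded_convergence _ _ _ _ _ _ (expR (expR (n%:R * K + a)))) => //.
- move=> m; rewrite /partial; apply: measurable_sum => k.
  apply: measurable_funM => //; apply: measurableT_comp => //.
  exact: measurable_funM.
- by move=> m w; exact: partial_bound.
- apply: aeW => w; under eq_fun do rewrite partialE.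
  exact: is_cvg_series_exp_coeff.
Qed.

Lemma Rintegral_double_expR n a :
  \int[P]_w expR (- expR (n%:R * X w + a)) =
  \int[P']_w expR (- expR (n%:R * Y w + a)).
Proof.
have := @Rintegral_double_expR_aux _ _ _ X n a XK.
under eq_fun do under eq_bigr do rewrite moments.
by move=> h; apply: (cvg_unique _ h (@Rintegral_double_expR_aux _ _ _ Y n a YK)).
Qed.

(** The offset [n%:R - (n * n)%:R * z] moves the threshold of [cvg_double_expR] from 0 to [z]. *)
Let cvg_halfline d0 (T0 : measurableType d0) (Q : probability T0 R)
    (Z : {RV Q >-> R}) (z : R) :
  \int[Q]_w expR (- expR ((n * n)%:R * Z w + (n%:R - (n * n)%:R * z)))
     @[n --> \oo] --> fine (distribution Q Z (`]-oo, z[)%classic).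
Proof.
have mZ : measurable (Z @^-1` (`]-oo, z[)%classic) by exact: measurable_funPTI.
have -> : fine (distribution Q Z (`]-oo, z[)%classic) = \int[Q]_w \1_(Z @^-1` (`]-oo, z[)%classic) w.
  by rewrite /Rintegral integral_indic// setIT.
apply: (@bounded_convergence _ _ _ _ _ _ 1) => //.
- move=> n; do 3 apply: measurableT_comp => //; apply: measurable_funD => //.
  exact: measurable_funM.
- move=> n w; by rewrite ger0_norm ?expR_ge0// -[leRHS]expR0 ler_expR oppr_le0.
- apply: aeW => w; rewrite indicE.
  have -> : (w \in Z @^-1` (`]-oo, z[)%classic) = (Z w - z < 0).
    by rewrite subr_lt0; apply/idP/idP; rewrite inE /= in_itv.
  have -> : (fun n : nat => expR (- expR ((n * n)%:R * Z w + (n%:R - (n * n)%:R * z))))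
      = (fun n : nat => expR (- expR ((n * n)%:R * (Z w - z) + n%:R))).
    by apply/funext => n; congr (expR (- expR _)); ring.
  exact: cvg_double_expR.
Qed.

(** Open left half-lines are stable under intersection and generate the Borel sets, and their
    probabilities are limits of the double exponential integrals. *)
Lemma distribution_eq_exponential_moments (A : set R) : measurable A ->
  distribution P X A = distribution P' Y A.
Proof.
move=> mA.
apply: (measure_unique (@RGenInftyO.G R) (fun n => `]-oo, n%:R[%classic)) => //.
- exact: RGenInftyO.measurableE.
- move=> _ _ [x ->] [y ->]; exists (Num.min x y).
  by apply/seteqP; split=> z /=; rewrite !in_itv /= lt_min => /andP.
- by move=> n; exists n%:R.
- rewrite -subTset => x _; exists (Num.truncn `|x|).+1 => //=.
  rewrite in_itv /=; apply: (le_lt_trans (ler_norm _)).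
  by rewrite truncnS_gt.
- move=> _ [z ->]; rewrite -[LHS]fineK ?fin_num_measure// -[RHS]fineK ?fin_num_measure//.
  congr EFin; have := @cvg_halfline _ _ _ X z.
  under eq_fun do rewrite Rintegral_double_expR.
  by move=> h; apply: (cvg_unique _ h (@cvg_halfline _ _ _ Y z)).
- by move=> n; rewrite -ge0_fin_numE// fin_num_measure.
Qed.

End exponential_moments.

(** Truncating the version at level [K] gives the bound at every point and not only almost surely,
    which is the form that [bounded_measurable] requires. *)
Lemma ae_limit_version_bounded {d} {T : measurableType d} {R : realType}
    (P : probability T R) (u : nat -> T -> R) (x : T -> R) (K : R) : 0 <= K ->
  (forall n, measurable_fun setT (u n)) -> (forall n w, `|u n w| <= K) ->
  {ae P, forall w, u n w @[n --> \oo] --> x w} ->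
  exists X : {RV P >-> R}, (forall w, `|X w| <= K) /\ {ae P, forall w, x w = X w}.
Proof.
move=> K0 mu uK ux; have [X xX] := ae_limit_version mu ux.
pose Y w := Num.max (- K) (Num.min K (X w)).
have mY : measurable_fun setT Y.
  by apply: measurable_maxr => //; exact: measurable_minr.
exists (mfun_of mY); split => [w|] /=.
  by rewrite /Y ler_norml le_max lexx /= ge_max ge_min lexx /= andbT; lra.
apply: filterS2 ux xX => w ux xX; rewrite /= /Y -xX.
have [xK Kx] : - K <= x w /\ x w <= K.
  split.
    by apply: (cvgr_to_ge ux); apply: nearW => n; have := uK n w; rewrite ler_norml => /andP[].
  by apply: (cvgr_to_le ux); apply: nearW => n; have := uK n w; rewrite ler_norml => /andP[].
by rewrite min_r// max_r.
Qed.

Lemma probability1_ae {d} {T : measurableType d} {R : realType}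
    (P : probability T R) (A : set T) :
  measurable A -> P A = 1%E -> {ae P, forall w, A w}.
Proof.
move=> mA PA; exists (~` A); split => //; first exact: measurableC.
by rewrite probability_setC// PA subee.
Qed.

(** * Truncated Brownian increments *)

Section density.
Context {R : realType}.
Local Notation mu := (@lebesgue_measure R).

(** The change of variables holds for the Radon-Nikodym derivative of [nu], and this derivative is
    almost everywhere equal to [g] because both have the same integral over every measurable set. *)
Lemma integral_density (nu : probability (measurableTypeR R) R) (f g : R -> R) :
  mu.-integrable setT (EFin \o g) ->
  (forall A, measurable A -> nu A = \int[mu]_(x in A) (g x)%:E)%E ->
  bounded_measurable (f : measurableTypeR R -> R) ->
  (\int[nu]_x (f x)%:E = \int[mu]_x (f x * g x)%:E)%E.
Proof.
move=> ig nug bf.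
have intf : nu.-integrable setT (EFin \o f) by exact: bounded_measurable_integrable.
have mg : measurable_fun setT (EFin \o g) by exact: measurable_int ig.
have mf : measurable_fun setT f by case: bf.
have numu : nu `<< mu.
  apply/null_content_dominatesP => A mA A0; rewrite nug//.
  by apply: null_set_integral => //; exact: measurable_funTS.
rewrite -(Radon_Nikodym_change_of_variables numu)//=.
apply: ae_eq_integral => //.
- apply: emeasurable_funM; first exact/measurable_EFinP.
  by apply: (measurable_int mu); exact: Radon_Nikodym_integrable.
- by apply/measurable_EFinP; apply: measurable_funM => //; exact/measurable_EFinP.
- under [X in ae_eq _ _ _ X]eq_fun do rewrite EFinM.
  apply: ae_eqe_mul2l => /=.
  rewrite Radon_NikodymE/=.
  case: cid => /= h [h1 h2 h3].
  apply: integral_ae_eq => //=.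
  by move=> E _ mE; rewrite -h3//= -nug.
Qed.

Lemma lebesgue_measure_opp (A : set R) : measurable A ->
  mu A = pushforward mu (-%R : measurableTypeR R -> measurableTypeR R) A.
Proof.
move=> mA; apply: lebesgue_measure_unique => // X [[a b] _ <-].
transitivity (mu `[- b, - a[%classic); last first.
  by congr (mu _); apply/seteqP; split => x /=; rewrite !in_itv /= lerNl ltrNr andbC.
by rewrite !lebesgue_measure_itv /= !lte_fin ltrN2 -!EFinB opprK addrC.
Qed.

Lemma integral_lebesgue_opp (h : R -> \bar R) : measurable_fun setT h ->
  mu.-integrable setT (h \o -%R) ->
  (\int[mu]_x h x = \int[mu]_x h (- x)%R)%E.
Proof.
move=> mh ih.
rewrite (eq_measure_integral
  (pushforward mu (-%R : measurableTypeR R -> measurableTypeR R)));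
  last by move=> A mA _; exact: lebesgue_measure_opp.
by rewrite integral_pushforward.
Qed.

End density.

Section normal.
Context {R : realType}.
Implicit Types s : R.
Local Notation mu := (@lebesgue_measure R).

Lemma Rintegral_normal_prob s (f : R -> R) :
  bounded_measurable (f : measurableTypeR R -> R) ->
  (\int[normal_prob 0 s]_x (f x)%:E = \int[mu]_x (f x * normal_pdf 0 s x)%:E)%E.
Proof.
move=> bf; apply: (@integral_density _ (normal_prob 0 s)) => //.
exact: integrable_normal_pdf.
Qed.

Lemma normal_pdfN s x : s != 0 -> normal_pdf 0 s (- x) = normal_pdf 0 s x.
Proof. by move=> s0; rewrite !normal_pdfE// /normal_fun !subr0 sqrrN. Qed.

Lemma integrable_bounded_normal s (f : R -> R) :
  bounded_measurable (f : measurableTypeR R -> R) ->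
  mu.-integrable setT (fun x => (f x * normal_pdf 0 s x)%:E).
Proof.
move=> [mf [K fK]].
apply: (@le_integrable _ _ _ mu setT measurableT _ (fun x => (K * normal_pdf 0 s x)%:E)).
- apply/measurable_EFinP; apply: measurable_funM => //; exact: measurable_normal_pdf.
- move=> x _; rewrite lee_fin normrM; apply: (le_trans _ (ler_norm _)).
  by rewrite [X in _ * X <= _]ger0_norm ?normal_pdf_ge0// ler_wpM2r ?normal_pdf_ge0.
- under eq_fun do rewrite EFinM.
  by apply: integrableZl => //; exact: integrable_normal_pdf.
Qed.

(** Reflecting the line preserves the normal density and negates [f], so the integral equals its own
    negative. *)
Lemma Rintegral_normal_odd s (f : R -> R) : s != 0 ->
  bounded_measurable (f : measurableTypeR R -> R) ->
  (forall x, f (- x) = - f x) -> \int[normal_prob 0 s]_x f x = 0.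
Proof.
move=> s0 bf fN.
suff : (\int[normal_prob 0 s]_x f x) = - (\int[normal_prob 0 s]_x f x) by lra.
rewrite {1}/Rintegral Rintegral_normal_prob//.
have i1 := integrable_bounded_normal s bf.
rewrite integral_lebesgue_opp; last 2 first.
- exact: measurable_int i1.
- have := integrable_bounded_normal s (bounded_measurableN bf).
  by apply: eq_integrable => // x _ /=; rewrite fN normal_pdfN.
under eq_integral do rewrite fN normal_pdfN// mulNr -mulN1r EFinM.
by rewrite integralZl// -Rintegral_normal_prob// Rintegral_bounded_fin//= mulN1r.
Qed.

Lemma normal_peak2 s : 0 < s -> normal_peak s = 2 * normal_peak (2 * s).
Proof.
move=> s0; rewrite /normal_peak.
have -> : (2 * s) ^+ 2 * pi *+ 2 = 2 ^+ 2 * (s ^+ 2 * pi *+ 2).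
  by rewrite exprMn !mulrnAr -!mulrA.
rewrite sqrtrM ?sqr_ge0// sqrtr_sqr ger0_norm// invfM mulrA mulfV ?mul1r//.
Qed.

(** A pointwise comparison that replaces the computation of the second moment. Doubling the standard
    deviation halves the peak and leaves the factor [expR (- u)] with
    [u = 3 * x ^+ 2 / (8 * s ^+ 2)]; since [u * expR (- u) <= 1], this factor absorbs [x ^+ 2]. The
    argument gives the constant 16/3, rounded up to 8. *)
Lemma sqr_normal_pdf_le s x : 0 < s ->
  x ^+ 2 * normal_pdf 0 s x <= 8 * s ^+ 2 * normal_pdf 0 (2 * s) x.
Proof.
move=> s0; have s20 : 2 * s != 0 by lra.
rewrite !normal_pdfE //; last by rewrite gt_eqF.
rewrite normal_peak2// /normal_fun !subr0.
have p0 : 0 < normal_peak (2 * s) by exact: normal_peak_gt0.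
set p := normal_peak _ in p0 *.
set u := 3 * x ^+ 2 / (8 * s ^+ 2).
have s2 : 0 < s ^+ 2 by rewrite exprn_gt0.
have xE : x ^+ 2 = 8 / 3 * s ^+ 2 * u by rewrite /u; field; rewrite gt_eqF.
have -> : - x ^+ 2 / (s ^+ 2 *+ 2) = - u + - x ^+ 2 / ((2 * s) ^+ 2 *+ 2).
  by rewrite /u; field; rewrite gt_eqF.
rewrite expRD; set E := expR (- x ^+ 2 / _).
have E0 : 0 < E by exact: expR_gt0.
have uu : u * expR (- u) <= 1.
  rewrite expRN -[leRHS](mulfV (lt0r_neq0 (expR_gt0 u))) ler_pM2r ?invr_gt0 ?expR_gt0//.
  by have := expR_ge1Dx u; lra.
rewrite {1}xE.
rewrite (_ : 8 / 3 * s ^+ 2 * u * (2 * p * (expR (- u) * E)) =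
   (16 / 3 * (u * expR (- u))) * (s ^+ 2 * p * E)); last by ring.
rewrite (_ : 8 * s ^+ 2 * (p * E) = 8 * (s ^+ 2 * p * E)); last by ring.
rewrite ler_pM2r ?mulr_gt0//; lra.
Qed.

Lemma Rintegral_normal_sqr_le s (f : R -> R) : 0 < s ->
  bounded_measurable (f : measurableTypeR R -> R) ->
  (forall x, f x <= x ^+ 2) -> \int[normal_prob 0 s]_x f x <= 8 * s ^+ 2.
Proof.
move=> s0 bf fx.
rewrite -lee_fin -Rintegral_bounded_fin// Rintegral_normal_prob//.
apply: (@le_trans _ _ (\int[mu]_x ((8 * s ^+ 2)%:E * (normal_pdf 0 (2 * s) x)%:E))%E).
  apply: le_integral => //.
  - exact: integrable_bounded_normal.
  - by apply: integrableZl => //; exact: integrable_normal_pdf.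
  - move=> x _; rewrite -EFinM lee_fin; apply: (le_trans _ (sqr_normal_pdf_le x s0)).
    by rewrite ler_wpM2r ?normal_pdf_ge0.
rewrite integralZl//; last exact: integrable_normal_pdf.
by rewrite integral_normal_pdf mule1.
Qed.

(** The density never exceeds its peak, which is at most [s^-1], and the interval has length
    [2 * C]. *)
Lemma normal_prob_itv_le s (C : R) : 0 < s -> 0 <= C ->
  (normal_prob 0 s `[(- C)%R, C] <= (2 * C / s)%:E)%E.
Proof.
move=> s0 C0; have sn0 : s != 0 by rewrite gt_eqF.
apply: (@le_trans _ _ (\int[mu]_(x in `[(- C)%R, C]) (normal_peak s)%:E)%E).
  apply: ge0_le_integral => //=.
  - by move=> x _; rewrite lee_fin normal_pdf_ge0.
  - by apply/measurable_EFinP/measurable_funTS; exact: measurable_normal_pdf.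
  - by move=> x _; rewrite lee_fin normal_pdf_ub.
rewrite integral_cst//= lebesgue_measure_itv /= lte_fin.
case: ifPn => [_|]; last by rewrite mule0 lee_fin divr_ge0 ?mulr_ge0// ltW.
rewrite -EFinB -EFinM lee_fin opprK mulrC.
rewrite (_ : C + C = 2 * C); last by ring.
rewrite ler_wpM2l ?mulr_ge0//.
rewrite /normal_peak lef_pV2 ?posrE//; last first.
  by rewrite sqrtr_gt0 mulrn_wgt0// mulr_gt0 ?pi_gt0// exprn_gt0.
rewrite -[leLHS](ger0_norm (ltW s0)) -sqrtr_sqr ler_wsqrtr//.
have s2 : 0 < s ^+ 2 by rewrite exprn_gt0.
rewrite -mulrnAr -[leLHS]mulr1 ler_wpM2l ?ltW//.
by have := pi_ge2 R; rewrite mulr2n; lra.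
Qed.

End normal.

(** Truncation keeps every Riemann sum bounded, hence integrable together with its square. It is
    odd, so clipped Brownian increments stay centred, and on a fine mesh it leaves the increments of
    a continuous path unchanged. *)
Definition clip {R : realType} (v : R) : R := Num.max (-1) (Num.min 1 v).

Section clip.
Context {R : realType}.
Implicit Types v : R.

Lemma clip_bound v : `|clip v| <= 1.
Proof.
rewrite ler_norml /clip le_max lexx /= ge_max ge_min lexx /= andbT; lra.
Qed.

Lemma clipN v : clip (- v) = - clip v.
Proof.
rewrite /clip; have [v1|v1] := lerP 1 v.
  rewrite [Num.min 1 (- v)]min_r; last lra.
  by rewrite max_l ?max_r//; lra.
have [v2|v2] := lerP 1 (- v).
  by rewrite max_r ?max_l ?opprK//; lra.
by rewrite !max_r//; lra.
Qed.

Lemma clip_sqr_le v : clip v ^+ 2 <= v ^+ 2.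
Proof.
rewrite /clip; case: (leP 1 v) => v1.
  by rewrite max_r ?expr1n; [nra|lra].
by have [v2|v2] := lerP (-1) v; nra.
Qed.

Lemma clip_id v : `|v| <= 1 -> clip v = v.
Proof. by rewrite /clip ler_norml => /andP[v1 v2]; rewrite min_r// max_r. Qed.

Lemma bounded_measurable_clip : bounded_measurable (clip : R -> R).
Proof.
split; last by exists 1; exact: clip_bound.
by apply: measurable_maxr => //; exact: measurable_minr.
Qed.

End clip.

(** * Sums of clipped Brownian increments with predictable coefficients *)

Section martingale_transform.
Context {d} {T : measurableType d} {R : realType} (P : probability T R).
Variables (F : R -> set (set T)) (B : R -> T -> R).
Hypothesis filF : is_filtration F.
Hypothesis brB : is_brownian P F 2 B.

Local Notation past t := (g_sigma_algebraType (F t)).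

Lemma adapted_measurable_fun (Y : R -> T -> R) (s t : R) :
  adapted F Y -> 0 <= s -> s <= t -> measurable_fun setT (Y s : past t -> R).
Proof.
move=> adY s0 st _ A mA; rewrite setTI; apply: sub_sigma_algebra.
exact: (filtration_mono filF s0 st (adY s s0 A mA)).
Qed.

Lemma measurable_fun_past d' (U : measurableType d') (s t : R) (f : T -> U) :
  0 <= s -> s <= t -> measurable_fun setT (f : past s -> U) ->
  measurable_fun setT (f : past t -> U).
Proof.
move=> s0 st mf _ A mA; have := mf measurableT A mA; rewrite !setTI.
by apply: sub_sigma_algebra2; exact: (filtration_mono filF s0 st).
Qed.

Lemma measurable_past d' (U : measurableType d') (s : R) (f : T -> U) :
  0 <= s -> measurable_fun setT (f : past s -> U) -> measurable_fun setT f.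
Proof.
move=> s0; apply: measurable_fun_g_sigma_algebra.
exact: filtration_measurable.
Qed.

Lemma bounded_measurable_past (s : R) (f : T -> R) : 0 <= s ->
  bounded_measurable (f : past s -> R) -> bounded_measurable f.
Proof. by move=> s0 [mf bf]; split => //; exact: measurable_past mf. Qed.

Section increment.
Variables s t : R.
Hypotheses (s0 : 0 <= s) (st : s < t).

Let t0 : 0 <= t. Proof. exact: le_trans s0 (ltW st). Qed.

Let mV : measurable_fun setT (B t \- B s).
Proof.
apply: (measurable_past t0); apply: measurable_funB.
  by apply: adapted_measurable_fun => //; exact: brownian_adapted brB.
by apply: adapted_measurable_fun => //; [exact: brownian_adapted brB|exact: ltW].
Qed.

Let V : {RV P >-> measurableTypeR R} := mfun_of (U := measurableTypeR R) mV.

Let Rintegral_V (f : R -> R) :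
  \int[distribution P V]_v f v = \int[normal_prob 0 (Num.sqrt (2 * (t - s)))]_v f v.
Proof.
congr fine; apply: eq_measure_integral => A mA _.
exact: (brownian_increment brB).
Qed.

Let freeze (f : past s * measurableTypeR R -> R) : bounded_measurable f ->
  \int[P]_w f (w, B t w - B s w) =
  \int[P]_w \int[normal_prob 0 (Num.sqrt (2 * (t - s)))]_v f (w, v).
Proof.
move=> bf; have sF := filtration_sigma filF s0.
rewrite (@freezing _ _ _ _ _ P (F s) V _ _ _ _ f) //.
- by apply: eq_Rintegral => w _; exact: Rintegral_V.
- exact: filtration_measurable.
- move=> A A' FA FA'; rewrite -(sigma_algebra_id sF).
  by apply: (@measurableI _ (past s)); exact: sub_sigma_algebra.
- by rewrite -(sigma_algebra_id sF); exact: (@measurableT _ (past s)).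
- exact: (brownian_indep brB).
Qed.

Let sd0 : 0 < Num.sqrt (2 * (t - s)).
Proof. by rewrite sqrtr_gt0 mulr_gt0// subr_gt0. Qed.

(** Once the past is frozen, the second term is an odd function integrated against a centred normal
    law. *)
Lemma increment_mean (M H : T -> R) :
  bounded_measurable (M : past s -> R) -> bounded_measurable (H : past s -> R) ->
  \int[P]_w (M w + H w * clip (B t w - B s w)) = \int[P]_w M w.
Proof.
move=> bM bH.
have bclip := @bounded_measurable_clip R.
rewrite (freeze (f := fun z => M z.1 + H z.1 * clip z.2)); last first.
  apply: bounded_measurableD; first exact: (bounded_measurable_comp measurable_fst).
  apply: bounded_measurableM; first exact: (bounded_measurable_comp measurable_fst).
  exact: (bounded_measurable_comp measurable_snd).
apply: eq_Rintegral => w _ /=.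
rewrite RintegralD//; last 2 first.
- by apply: bounded_measurable_integrable; exact: bounded_measurable_cst.
- apply: (bounded_measurable_integrable (normal_prob 0 _)).
  by apply: bounded_measurableM => //; exact: bounded_measurable_cst.
rewrite Rintegral_prob_cst RintegralZl//; last exact: bounded_measurable_integrable.
by rewrite Rintegral_normal_odd ?mulr0 ?addr0//; [rewrite gt_eqF|exact: clipN].
Qed.

(** The cross term vanishes because the clipped increment is centred given the past. The factor 16
    is the constant 8 of [Rintegral_normal_sqr_le] times the 2 in the variance [2 * (t - s)]. *)
Lemma increment_square (M H : T -> R) (C : R) :
  bounded_measurable (M : past s -> R) -> measurable_fun setT (H : past s -> R) ->
  (forall w, `|H w| <= C) ->
  \int[P]_w (M w + H w * clip (B t w - B s w)) ^+ 2 <=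
    \int[P]_w M w ^+ 2 + 16 * (t - s) * C ^+ 2.
Proof.
move=> bM mH HC.
have bH : bounded_measurable (H : past s -> R) by split => //; exists C.
have bclip := @bounded_measurable_clip R.
have bclip2 : bounded_measurable (fun v : R => clip v ^+ 2).
  by under eq_fun do rewrite expr2; exact: bounded_measurableM.
have bM2 : bounded_measurable (fun w => M w ^+ 2).
  by under eq_fun do rewrite expr2; apply: bounded_measurableM => //; exact: bounded_measurable_past bM.
have bsum : bounded_measurable
    (fun z : past s * measurableTypeR R => M z.1 + H z.1 * clip z.2).
  apply: bounded_measurableD; first exact: (bounded_measurable_comp measurable_fst).
  apply: bounded_measurableM; first exact: (bounded_measurable_comp measurable_fst).
  exact: (bounded_measurable_comp measurable_snd).
rewrite (freeze (f := fun z => (M z.1 + H z.1 * clip z.2) ^+ 2)); last first.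
  by under eq_fun do rewrite expr2; exact: bounded_measurableM.
set nu := normal_prob _ _.
have nclip : \int[nu]_v clip v = 0.
  by rewrite Rintegral_normal_odd//; [rewrite gt_eqF|exact: clipN].
pose k := \int[nu]_v clip v ^+ 2.
have k_le : k <= 16 * (t - s).
  apply: (le_trans (Rintegral_normal_sqr_le sd0 bclip2 (@clip_sqr_le R))).
  have ts : 0 <= 2 * (t - s) by rewrite mulr_ge0// subr_ge0 ltW.
  by rewrite sqr_sqrtr//; lra.
have inner w : \int[nu]_v (M w + H w * clip v) ^+ 2 = M w ^+ 2 + H w ^+ 2 * k.
  have -> : (fun v => (M w + H w * clip v) ^+ 2) =
      (fun v => M w ^+ 2 + 2 * M w * H w * clip v + H w ^+ 2 * clip v ^+ 2).
    by apply/funext => v; ring.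
  have b1 : bounded_measurable (fun v : R => 2 * M w * H w * clip v).
    by apply: bounded_measurableM => //; exact: bounded_measurable_cst.
  have b2 : bounded_measurable (fun v : R => H w ^+ 2 * clip v ^+ 2).
    by apply: bounded_measurableM => //; exact: bounded_measurable_cst.
  have b0 := @bounded_measurable_cst _ R R (M w ^+ 2).
  rewrite RintegralD//; do ?exact: bounded_measurable_integrable; last first.
    by apply: bounded_measurable_integrable; exact: bounded_measurableD.
  rewrite RintegralD//; do ?exact: bounded_measurable_integrable.
  rewrite Rintegral_prob_cst !RintegralZl//; do ?exact: bounded_measurable_integrable.
  by rewrite nclip mulr0 addr0.
rewrite (eq_Rintegral _ (g := fun w => M w ^+ 2 + H w ^+ 2 * k)); last first.
  by move=> w _ /=; exact: inner.
have bH' : bounded_measurable H by exact: bounded_measurable_past bH.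
have bH2k : bounded_measurable (fun w => H w ^+ 2 * k).
  under eq_fun do rewrite expr2.
  by apply: bounded_measurableM; [exact: bounded_measurableM|exact: bounded_measurable_cst].
rewrite RintegralD//; do ?exact: bounded_measurable_integrable.
rewrite lerD2l -[leRHS](Rintegral_prob_cst P); apply: le_Rintegral => //.
- exact: bounded_measurable_integrable.
- by apply: bounded_measurable_integrable; exact: bounded_measurable_cst.
- move=> w _; rewrite mulrC.
  have k0 : 0 <= k by apply: Rintegral_ge0 => v _; exact: sqr_ge0.
  apply: ler_pM => //; first exact: sqr_ge0.
  by rewrite -real_normK ?num_real// ler_sqr ?nnegrE// (le_trans (normr_ge0 (H w))).
Qed.

End increment.

Variables (h : R) (H : nat -> T -> R) (C : R).
Hypotheses (h0 : 0 < h) (HC : forall i w, `|H i w| <= C).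
Hypothesis mH : forall i, measurable_fun setT (H i : past (i%:R * h) -> R).

Definition clipped_transform (m : nat) (w : T) : R :=
  \sum_(i < m) H i w * clip (B (i.+1%:R * h) w - B (i%:R * h) w).

(** The second moments add up over the steps, as for orthogonal increments. The bound depends on [m]
    and [h] only through the elapsed time [m%:R * h], so it does not deteriorate when the mesh is
    refined. *)
Lemma clipped_transformP m :
  [/\ bounded_measurable (clipped_transform m : past (m%:R * h) -> R),
      \int[P]_w clipped_transform m w = 0 &
      \int[P]_w clipped_transform m w ^+ 2 <= m%:R * (16 * h * C ^+ 2)].
Proof.
have g0 k : 0 <= k%:R * h by rewrite mulr_ge0// ltW.
have gS k : k%:R * h < k.+1%:R * h by rewrite ltr_pM2r// ltr_nat.
elim: m => [|m [bM M0 M2]].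
  have E : clipped_transform 0 = fun=> 0 by apply/funext => w; rewrite /clipped_transform big_ord0.
  rewrite E; split; first exact: bounded_measurable_cst.
    by rewrite Rintegral_prob_cst.
  by rewrite Rintegral_prob_cst expr0n mul0r.
have E : clipped_transform m.+1 = fun w => clipped_transform m w +
    H m w * clip (B (m.+1%:R * h) w - B (m%:R * h) w).
  by apply/funext => w; rewrite /clipped_transform big_ord_recr.
have bH : bounded_measurable (H m : past (m%:R * h) -> R) by split => //; exists C.
rewrite E; split.
- have up (f : T -> R) : bounded_measurable (f : past (m%:R * h) -> R) ->
      bounded_measurable (f : past (m.+1%:R * h) -> R).
    by move=> [mf bf]; split => //; apply: measurable_fun_past mf => //; exact: ltW.
  apply: bounded_measurableD; first exact: up.
  apply: bounded_measurableM; first exact: up.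
  apply: (bounded_measurable_comp (f := clip)); last exact: bounded_measurable_clip.
  apply: measurable_funB; apply: adapted_measurable_fun => //.
  + exact: brownian_adapted brB.
  + exact: brownian_adapted brB.
  + exact: ltW.
- by rewrite increment_mean.
- apply: (le_trans (increment_square (g0 m) (gS m) bM (@mH m) (HC m))).
  apply: (le_trans (lerD M2 (lexx _))).
  by rewrite le_eqVlt -natr1; apply/orP; left; apply/eqP; ring.
Qed.

End martingale_transform.

(** * The telegraph process *)

Section exponential_law.
Context {R : realType}.
Local Notation mu := (@lebesgue_measure R).

Lemma is_derive_expRM (k a x : R) :
  is_derive x 1 (fun v : R => k * expR (a * v)) (k * (a * expR (a * x))).
Proof.
have h : is_derive x 1 (fun v : R => a * v) a.
  by have := is_deriveZ a (is_derive_id x (1 : R)); rewrite /GRing.scale /= mulr1.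
have h2 : is_derive x 1 (expR \o (fun v : R => a * v)) (a * expR (a * x)).
  by rewrite mulrC; apply: is_derive1_comp.
exact: (is_deriveZ k h2).
Qed.

Lemma continuous_expRM (k a : R) : continuous (fun v : R => k * expR (a * v)).
Proof.
move=> x; apply: differentiable_continuous; apply/derivable1_diffP.
exact: (ex_derive (is_derive := is_derive_expRM k a x)).
Qed.

Lemma integral_expRM (k a u : R) : a != 0 -> 0 <= u ->
  (\int[mu]_(v in `[0%R, u]) (k * expR (a * v))%:E =
   (k / a * (expR (a * u) - 1))%:E)%E.
Proof.
move=> a0; rewrite le_eqVlt => /predU1P[<-|u0].
  by rewrite set_itv1 integral_set1 mulr0 expR0 subrr mulr0.
rewrite (@continuous_FTC2 _ _ (fun v => k / a * expR (a * v)))//.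
- by rewrite mulr0 expR0 -EFinB mulr1 mulrBr mulr1.
- by apply: continuous_subspaceT; exact: continuous_expRM.
- split.
  + by move=> x _; exact: (ex_derive (is_derive := is_derive_expRM _ _ x)).
  + by apply: cvg_at_right_filter; exact: continuous_expRM.
  + by apply: cvg_at_left_filter; exact: continuous_expRM.
- move=> x _; rewrite derive1E.
  rewrite (derive_val (is_derive := is_derive_expRM _ _ x)).
  by rewrite mulrA divfK.
Qed.

Variable rate : R.
Hypothesis rate_gt0 : 0 < rate.

Lemma exponential_prob_tail (x : R) : 0 <= x ->
  exponential_prob rate `]x, +oo[ = (expR (- (rate * x)))%:E.
Proof.
move=> x0.
have mpdf : measurable_fun setT (EFin \o exponential_pdf rate).
  by apply/measurable_EFinP; exact: measurable_exponential_pdf.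
rewrite /exponential_prob integral_itv_obnd_cbnd; last exact: measurable_funTS.
rewrite (eq_integral (fun v : measurableTypeR R => (rate * expR (- rate * v))%:E)); last first.
  move=> v; rewrite inE /= in_itv /= andbT => xv.
  by rewrite exponential_pdfE// (le_trans x0).
rewrite (@ge0_continuous_FTC2y _ _ (fun v => - 1 * expR (- rate * v)) x 0).
- by rewrite mulN1r -EFinB opprK add0r mulNr.
- by move=> v _; rewrite mulr_ge0 ?expR_ge0// ltW.
- by apply: continuous_subspaceT; exact: continuous_expRM.
- rewrite -(mulr0 (-1)); apply: cvgM; first exact: cvg_cst.
  under eq_fun do rewrite mulNr.
  apply: (@cvg_comp _ _ _ (fun z => rate * z) (fun z => expR (- z)) _ (pinfty_nbhs R));
    last exact: cvgr_expR.
  exact: gt0_cvgMry.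
- by move=> v _; exact: (ex_derive (is_derive := is_derive_expRM _ _ v)).
- by apply: cvg_at_right_filter; exact: continuous_expRM.
- move=> v _; rewrite derive1E (derive_val (is_derive := is_derive_expRM _ _ v)).
  by rewrite mulNr mul1r mulNr opprK.
Qed.

Variable nu : probability (measurableTypeR R) R.
Hypothesis nu_tail : forall x : R, 0 <= x ->
  nu `]x, +oo[%classic = (expR (- (rate * x)))%:E.

Lemma prob_tail_lt0 (N : probability (measurableTypeR R) R) (x : R) : x < 0 ->
  N `]0, +oo[%classic = 1%E -> N `]x, +oo[%classic = 1%E.
Proof.
move=> x0 N1; apply/eqP; rewrite eq_le; apply/andP; split; first exact: probability_le1.
rewrite -N1; apply: le_measure; rewrite ?inE//.
by move=> v /=; rewrite !in_itv /= !andbT; exact: lt_trans.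
Qed.

(** Right half-lines are stable under intersection and generate the Borel sets. Those starting at a
    nonnegative point are given by the tail; the others contain the positive half-line, which
    already has probability 1. *)
Lemma exponential_prob_eq (A : set (measurableTypeR R)) : measurable A ->
  nu A = exponential_prob rate A.
Proof.
pose E : probability (measurableTypeR R) R :=
  exponential_distribution_exponential_prob__canonical__probability_measure_Probability rate_gt0.
move=> mA; rewrite -[RHS]/(E A).
have E_tail (x : R) : 0 <= x -> E `]x, +oo[%classic = (expR (- (rate * x)))%:E.
  exact: exponential_prob_tail.
apply: (@measure_unique _ _ (measurableTypeR R) (@RGenOInfty.G R) (fun n : nat => `]- n%:R, +oo[%classic)) => //.
- exact: RGenOInfty.measurableE.
- move=> _ _ [x ->] [y ->]; exists (Num.max x y).
  by apply/seteqP; split=> z /=; rewrite !in_itv /= !andbT gt_max => /andP.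
- by move=> n; exists (- n%:R).
- rewrite -subTset => x _; exists (Num.truncn `|x|).+1 => //=.
  rewrite in_itv /= andbT ltrNl; apply: (le_lt_trans (ler_norm _)).
  by rewrite normrN truncnS_gt.
- move=> _ [x ->]; have [x0|x0] := leP 0 x.
    by transitivity (expR (- (rate * x)))%:E; [exact: nu_tail|exact/esym/E_tail].
  transitivity (1%E : \bar R); [|apply/esym]; apply: prob_tail_lt0 => //.
    by rewrite nu_tail// mulr0 oppr0 expR0.
  by rewrite E_tail// mulr0 oppr0 expR0.
- by move=> n; rewrite -ge0_fin_numE// fin_num_measure.
Qed.

Lemma bounded_measurable_step (a c u : R) : 0 <= u ->
  bounded_measurable (fun v : measurableTypeR R =>
    expR (a * Num.min (Num.max 0 v) u) * (1 - c * (u < Num.max 0 v)%R%:R)).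
Proof.
move=> u0; have mmax : measurable_fun setT (fun v : measurableTypeR R => Num.max 0 v).
  exact: measurable_maxr.
apply: bounded_measurableM.
  split.
    apply: measurableT_comp => //; apply: measurable_funM => //.
    exact: measurable_minr.
  exists (expR (`|a| * u)) => v; rewrite ger0_norm ?expR_ge0// ler_expR.
  rewrite (le_trans (ler_norm _))// normrM ler_wpM2l// ger0_norm.
    by rewrite ge_min lexx orbT.
  by rewrite le_min u0 le_max lexx.
apply: bounded_measurableB; first exact: bounded_measurable_cst.
apply: bounded_measurableM; first exact: bounded_measurable_cst.
split; last by exists 1 => v; case: (_ < _); rewrite ?normr1 ?normr0.
rewrite (_ : (fun v => _) = (fun v : R => if u < Num.max 0 v then 1 else 0 : R)); last first.
  by apply/funext => v; case: (_ < _).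
apply: measurable_fun_ifT => //.
exact: (measurable_fun_ltr (f := cst u)).
Qed.

(* One telegraph step: the hypothesis [c * (a - rate) = a] makes the jump term
   [1 - c] compensate the growth of [expR (a * v)] up to the horizon [u]. *)
Lemma Rintegral_exponential_step (a c u : R) : 0 <= u -> a != rate ->
  c * (a - rate) = a ->
  \int[nu]_v (expR (a * Num.min (Num.max 0 v) u) *
              (1 - c * (u < Num.max 0 v)%R%:R)) = 1 - c.
Proof.
move=> u0 ar ca.
have ar0 : a - rate != 0 by rewrite subr_eq0.
have mpdf : measurable_fun setT (EFin \o exponential_pdf rate).
  by apply/measurable_EFinP; exact: measurable_exponential_pdf.
(* The integrand is split at the horizon: [f1] covers a jump by time [u] and is integrated against
   the density, [f2] covers a later jump and is constant there. *)
pose f1 (v : R) := expR (a * Num.min (Num.max 0 v) u) * \1_(`]-oo, u]%classic : set R) v.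
pose f2 (v : R) := expR (a * u) * (1 - c) * \1_(`]u, +oo[%classic : set R) v.
have -> : (fun v : R => expR (a * Num.min (Num.max 0 v) u) *
              (1 - c * (u < Num.max 0 v)%R%:R)) = (fun v => f1 v + f2 v).
  apply/funext => v; rewrite /f1 /f2 !indicE !mem_setE !in_itv /= !andbT.
  rewrite lt_max [(u < 0)]ltNge u0 /= [(u < v)]ltNge.
  have [vu|uv] /= := leP v u; first by rewrite !mulr0 subr0 addr0.
  rewrite min_r ?mulr1 ?mulr0 ?add0r//.
  by rewrite le_max (ltW uv) orbT.
have b1 : bounded_measurable (f1 : measurableTypeR R -> R).
  apply: bounded_measurableM; last first.
    by apply: (@bounded_measurable_indic _ (measurableTypeR R)); exact: measurable_itv.
  split.
    apply: measurableT_comp => //; apply: measurable_funM => //.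
    by apply: measurable_minr => //; exact: measurable_maxr.
  exists (expR (`|a| * u)) => v; rewrite ger0_norm ?expR_ge0// ler_expR.
  rewrite (le_trans (ler_norm _))// normrM ler_wpM2l// ger0_norm.
    by rewrite ge_min lexx orbT.
  by rewrite le_min u0 le_max lexx.
have b2 : bounded_measurable (\1_(`]u, +oo[%classic : set R) : measurableTypeR R -> R).
  by apply: (@bounded_measurable_indic _ (measurableTypeR R)); exact: measurable_itv.
have b2' : bounded_measurable (f2 : measurableTypeR R -> R).
  by apply: bounded_measurableM => //; exact: bounded_measurable_cst.
rewrite RintegralD//; do ?exact: bounded_measurable_integrable.
rewrite RintegralZl//; do ?exact: bounded_measurable_integrable.
have -> : \int[nu]_v \1_(`]u, +oo[%classic : set R) v = expR (- (rate * u)).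
  rewrite /Rintegral integral_indic// setIT; exact: (congr1 fine) (nu_tail u0).
have -> : \int[nu]_v f1 v = rate / (a - rate) * (expR ((a - rate) * u) - 1).
  rewrite /Rintegral (@integral_density _ _ _ (exponential_pdf rate))//; last 2 first.
  - exact: integrable_exponential_pdf.
  - by move=> A mA; rewrite exponential_prob_eq.
  transitivity (fine (\int[mu]_(v in `[0%R, u]) (rate * expR ((a - rate) * v))%:E)).
    congr fine; rewrite [RHS]integral_mkcond; apply: eq_integral => v _.
    rewrite patchE /f1 indicE !mem_setE !in_itv /=.
    have [v0|v0] /= := leP 0 v; last by rewrite lt0_exponential_pdf ?mulr0.
    have [vu|uv] /= := leP v u; last by rewrite mulr0 mul0r.
    rewrite exponential_pdfE// mulr1 mulrCA -expRD.
    by congr (_ * expR _)%:E; ring.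
  by rewrite integral_expRM.
have -> : expR (a * u) * (1 - c) * expR (- (rate * u)) = (1 - c) * expR ((a - rate) * u).
  by rewrite mulrAC -expRD mulrC; congr (_ * expR _); ring.
set E := expR _.
(* With this value the exponential [E] cancels: [(c - 1) * (E - 1) + (1 - c) * E = 1 - c]. *)
have -> : rate / (a - rate) = c - 1.
  by apply: (mulIf ar0); rewrite divfK// mulrBl ca; ring.
by ring.
Qed.

End exponential_law.

(** * Telegraph paths stopped at an arrival time *)

Section telegraph_path.
Context {R : realType}.
Variables (t : R) (s x : nat -> R).
Hypotheses (t0 : 0 <= t) (x0 : forall i, 0 <= x i) (s1 : forall i, `|s i| <= 1).

(** The position of the telegraph path at the time [Num.min (arrival_time x n) t]: a wait that
    begins before [t] counts only for its part before [t], a later one not at all. *)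
Definition stopped_displacement (n : nat) : R :=
  \sum_(i < n) s i * Num.min (x i) (Num.max 0 (t - arrival_time x i)).

(** The sign of the waiting interval that contains [t] if this is one of the first [n] intervals,
    and 0 as long as [t] has not been passed. At most one term of the sum is nonzero. *)
Definition stopped_velocity (n : nat) : R :=
  \sum_(i < n) s i *
    ((arrival_time x i <= t) && (t < arrival_time x i.+1))%R%:R.

Lemma arrival_timeS n : arrival_time x n.+1 = arrival_time x n + x n.
Proof. by rewrite /arrival_time big_ord_recr. Qed.

Lemma arrival_time0 : arrival_time x 0 = 0.
Proof. by rewrite /arrival_time big_ord0. Qed.

Lemma stopped_displacementS n : stopped_displacement n.+1 =
  stopped_displacement n + s n * Num.min (x n) (Num.max 0 (t - arrival_time x n)).
Proof. by rewrite /stopped_displacement big_ord_recr. Qed.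

Lemma stopped_velocityS n : stopped_velocity n.+1 = stopped_velocity n +
  s n * ((arrival_time x n <= t) && (t < arrival_time x n + x n))%R%:R.
Proof. by rewrite /stopped_velocity big_ord_recr /= arrival_timeS. Qed.

Lemma le_arrival_time m n : (m <= n)%N -> arrival_time x m <= arrival_time x n.
Proof.
elim: n => [|n IH]; first by rewrite leqn0 => /eqP ->.
rewrite leq_eqVlt => /predU1P[->//|]; rewrite ltnS => /IH /le_trans; apply.
by rewrite arrival_timeS lerDl.
Qed.

Lemma arrival_time_ge0 n : 0 <= arrival_time x n.
Proof. by rewrite -arrival_time0 le_arrival_time. Qed.

Lemma min_arrival_timeS n : Num.min (arrival_time x n + x n) t =
  Num.min (arrival_time x n) t + Num.min (x n) (Num.max 0 (t - arrival_time x n)).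
Proof.
have := x0 n; set a := arrival_time x n; set z := x n => z0.
have [ta|ta] := lerP t a.
  rewrite [Num.max _ _]max_l ?subr_le0// (min_r z0) addr0 min_r//.
  by apply: (le_trans ta); rewrite lerDl.
rewrite [Num.max _ _]max_r ?subr_ge0 ?(ltW ta)//.
by have [h|h] := lerP z (t - a); [rewrite min_l|rewrite min_r]; lra.
Qed.

Lemma stopped_displacement_bound n :
  `|stopped_displacement n| <= Num.min (arrival_time x n) t.
Proof.
elim: n => [|n IH].
  by rewrite /stopped_displacement big_ord0 normr0 arrival_time0 min_l.
rewrite stopped_displacementS arrival_timeS min_arrival_timeS.
apply: (le_trans (ler_normD _ _)); apply: lerD => //.
have h : 0 <= Num.min (x n) (Num.max 0 (t - arrival_time x n)).
  by rewrite le_min x0 le_max lexx.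
by rewrite normrM (ger0_norm h) ler_piMl.
Qed.

Lemma stopped_displacement_le n : `|stopped_displacement n| <= t.
Proof. by rewrite (le_trans (stopped_displacement_bound n))// ge_min lexx orbT. Qed.

Lemma stopped_velocity_before n : arrival_time x n <= t -> stopped_velocity n = 0.
Proof.
move=> nt; rewrite /stopped_velocity big1// => i _.
by rewrite [t < _]ltNge (le_trans (le_arrival_time (ltn_ord i)) nt) andbF mulr0.
Qed.

Lemma stopped_velocity_bound n : `|stopped_velocity n| <= 1.
Proof.
elim: n => [|n IH]; first by rewrite /stopped_velocity big_ord0 normr0.
rewrite stopped_velocityS; have [nt|nt] /= := lerP (arrival_time x n) t.
  rewrite stopped_velocity_before// add0r normrM normr_nat.
  by case: (_ < _); rewrite ?mulr1 ?mulr0.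
by rewrite mulr0 addr0.
Qed.

End telegraph_path.

Section telegraph_limit.
Context {R : realType}.
Variables (t : R) (s x : nat -> R) (m : nat).
Hypotheses (t0 : 0 <= t) (x0 : forall i, 0 < x i).
Hypothesis mt : t < arrival_time x m.

Let x_ge0 i : 0 <= x i. Proof. exact: ltW. Qed.

(** Arrival times are monotone, so the bracketing index is the largest one whose arrival time is at
    most [t]; the choice made by [xget] is forced and its default value does not occur. *)
Lemma arrival_countP (n : nat) : arrival_time x n <= t < arrival_time x n.+1 ->
  arrival_count x t = n.
Proof.
move=> /andP[nt tn]; rewrite /arrival_count; case: xgetP => [k -> [kt kmax]|].
  apply/eqP; rewrite eqn_leq (kmax _ nt) andbT leqNgt; apply/negP => nk.
  have := le_arrival_time x_ge0 nk; move: kt tn; lra.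
move=> /(_ n)[]; split => // k kt; rewrite leqNgt; apply/negP => nk.
have := le_arrival_time x_ge0 nk; move: kt tn; lra.
Qed.

Lemma arrival_countE : arrival_time x (arrival_count x t) <= t <
  arrival_time x (arrival_count x t).+1.
Proof.
have exm : exists k, t < arrival_time x k by exists m.
case: (ex_minnP exm) => -[|k] kt kmin.
  by move: kt; rewrite arrival_time0 ltNge t0.
have h : arrival_time x k <= t < arrival_time x k.+1.
  rewrite kt andbT leNgt; apply/negP => /kmin; rewrite ltnn//.
by rewrite (arrival_countP h).
Qed.

Let N := arrival_count x t.

Lemma stopped_displacementE k : (N < k)%N ->
  stopped_displacement t s x k = telegraph s x t.
Proof.
have /andP[Nt tN] := arrival_countE; rewrite -/N in Nt tN.
elim: k => // k IH; rewrite ltnS leq_eqVlt => /predU1P[<-|Nk].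
  rewrite stopped_displacementS /telegraph -/N; congr (_ + _ * _).
    rewrite /stopped_displacement; apply: eq_bigr => i _; congr (_ * _).
    have := le_arrival_time x_ge0 (ltn_ord i); rewrite arrival_timeS => h.
    rewrite max_r ?min_l//; first lra.
    by have := x_ge0 i; lra.
  rewrite max_r ?subr_ge0// min_r//; move: tN; rewrite arrival_timeS; lra.
rewrite stopped_displacementS IH// max_l ?min_r ?mulr0 ?addr0//.
rewrite subr_le0; apply: (le_trans (ltW tN)); exact: le_arrival_time.
Qed.

Lemma stopped_velocityE k : (N < k)%N -> stopped_velocity t s x k = s N.
Proof.
have /andP[Nt tN] := arrival_countE; rewrite -/N in Nt tN.
elim: k => // k IH; rewrite ltnS leq_eqVlt => /predU1P[<-|Nk].
  rewrite stopped_velocityS stopped_velocity_before// Nt -arrival_timeS tN.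
  by rewrite mulr1 add0r.
rewrite stopped_velocityS IH// [_ <= t]leNgt.
by rewrite (lt_le_trans tN (le_arrival_time x_ge0 Nk)) mulr0 addr0.
Qed.

Lemma min_arrival_timeE k : (N < k)%N -> Num.min (arrival_time x k) t = t.
Proof.
have /andP[_ tN] := arrival_countE; rewrite -/N in tN => Nk.
by rewrite min_r// (le_trans (ltW tN))// le_arrival_time.
Qed.

End telegraph_limit.

(** * Independence of the next sign and the next wait from the past *)

Section telegraph_martingale.
Context {d} {T : measurableType d} {R : realType} (P : probability T R).
Variables (rate : R) (theta e : nat -> {RV P >-> R}).
Hypothesis rate_gt0 : 0 < rate.
Hypothesis tel : is_telegraph_data rate theta e.

Lemma set_iota n : [set` iota 0 n] = [set i | (i < n)%N].
Proof. by apply/seteqP; split => i; rewrite /= mem_iota. Qed.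

Definition cylinder (m n : nat) (A B : nat -> set R) : set T :=
  (\bigcap_(i in [set` iota 0 m]) theta i @^-1` A i) `&`
  (\bigcap_(i in [set` iota 0 n]) e i @^-1` B i).

(** A family stable under intersection that generates the sigma-algebra of the first [m] signs and
    the first [n] waits. Two indices are kept because signs and waits are revealed alternately. *)
Definition cylinders (m n : nat) : set (set T) :=
  [set S | exists A B : nat -> set R, [/\ (forall i, measurable (A i)),
    (forall i, measurable (B i)) & S = cylinder m n A B]].

Lemma sigma_gen_bigcap (X : nat -> {RV P >-> R}) (m : nat) (A : nat -> set R) :
  (forall i, measurable (A i)) ->
  sigma_gen X (\bigcap_(i in [set` iota 0 m]) X i @^-1` A i).
Proof.
move=> mA.
apply: (@fin_bigcap_measurable _ (g_sigma_algebraType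
  (\bigcup_i preimage_set_system setT (X i) measurable))).
  exact: finite_seq.
move=> i _; apply: sub_sigma_algebra; exists i => //.
by exists (A i) => //; rewrite setTI.
Qed.

Lemma probability_cylinder m n A B :
  (forall i, measurable (A i)) -> (forall i, measurable (B i)) ->
  P (cylinder m n A B) = (\prod_(i <- iota 0 m) P (theta i @^-1` A i) *
    \prod_(i <- iota 0 n) P (e i @^-1` B i))%E.
Proof.
move=> mA mB; rewrite /cylinder (telegraph_indep tel); try exact: sigma_gen_bigcap.
rewrite (telegraph_sign_indep tel) ?iota_uniq// (telegraph_wait_indep tel) ?iota_uniq//.
Qed.

Lemma cylinders_measurable m n : cylinders m n `<=` measurable.
Proof.
move=> _ [A [B [mA mB ->]]]; apply: measurableI.
  by apply: fin_bigcap_measurable; [exact: finite_seq|move=> i _; exact: measurable_funPTI].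
by apply: fin_bigcap_measurable; [exact: finite_seq|move=> i _; exact: measurable_funPTI].
Qed.

Lemma cylindersI m n : setI_closed (cylinders m n).
Proof.
move=> _ _ [A [B [mA mB ->]]] [A' [B' [mA' mB' ->]]].
exists (fun i => A i `&` A' i), (fun i => B i `&` B' i); split.
- by move=> i; exact: measurableI.
- by move=> i; exact: measurableI.
- by rewrite /cylinder setIACA -!bigcapI.
Qed.

Lemma cylindersT m n : cylinders m n setT.
Proof.
exists (fun=> setT), (fun=> setT); split => //.
by rewrite /cylinder; apply/seteqP; split => // w _; split => i.
Qed.

Lemma prod_iotaS (f : nat -> \bar R) n (c : \bar R) :
  (\prod_(i <- iota 0 n.+1) (if i == n then c else f i) =
   \prod_(i <- iota 0 n) f i * c)%E.
Proof.
rewrite -addn1 iotaD big_cat big_seq1 /= add0n eqxx; congr (_ * _)%E.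
apply: eq_big_seq => i; rewrite mem_iota add0n => /andP[_ ni].
by rewrite ltn_eqF.
Qed.

Lemma bigcap_iotaS (X : nat -> T -> R) n (A : nat -> set R) (C : set R) :
  (\bigcap_(i in [set` iota 0 n]) X i @^-1` A i) `&` X n @^-1` C =
  \bigcap_(i in [set` iota 0 n.+1]) X i @^-1` (if i == n then C else A i).
Proof.
rewrite !set_iota; apply/seteqP; split => [w [wA wC] i /=|w wA].
  by rewrite ltnS leq_eqVlt; case: eqP => [->//|_ /= ni]; exact: wA.
split => [i /= ni|].
  by have := wA i; rewrite /= ltnS (ltnW ni) ltn_eqF//; exact.
by have := wA n; rewrite /= ltnSn eqxx; exact.
Qed.

(** Intersecting a cylinder with an event of the next wait gives a cylinder with one more wait, so
    the product formula evaluates both sides. *)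
Lemma indep_wait m n :
  indep_systems P (cylinders m n) (preimage_set_system setT (e n) measurable).
Proof.
move=> _ _ [A [B [mA mB ->]]] [C mC <-]; rewrite setTI.
rewrite /cylinder -setIA bigcap_iotaS -/(cylinder m n.+1 A _).
rewrite !probability_cylinder//; last by move=> i; case: ifP.
have H (i : nat) : P (e i @^-1` (if i == n then C else B i)) =
    (if i == n then P (e n @^-1` C) else P (e i @^-1` B i)).
  by case: eqP => [->|].
under [X in (_ * X)%E]eq_bigr do rewrite H.
by rewrite prod_iotaS muleA.
Qed.

Lemma indep_sign m n :
  indep_systems P (cylinders m n) (preimage_set_system setT (theta m) measurable).
Proof.
move=> _ _ [A [B [mA mB ->]]] [C mC <-]; rewrite setTI.
rewrite /cylinder setIAC bigcap_iotaS -/(cylinder m.+1 n _ B).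
rewrite !probability_cylinder//; last by move=> i; case: ifP.
have H (i : nat) : P (theta i @^-1` (if i == m then C else A i)) =
    (if i == m then P (theta m @^-1` C) else P (theta i @^-1` A i)).
  by case: eqP => [->|].
under [X in (X * _)%E]eq_bigr do rewrite H.
by rewrite prod_iotaS muleAC.
Qed.

Local Notation past m n := (g_sigma_algebraType (cylinders m n)).

Lemma measurable_sign_past m n i : (i < m)%N ->
  measurable_fun setT (theta i : past m n -> R).
Proof.
move=> im _ C mC; rewrite setTI; apply: sub_sigma_algebra.
exists (fun j => if j == i then C else setT), (fun=> setT); split => //.
  by move=> j; case: ifP.
rewrite /cylinder !set_iota; apply/seteqP; split => [w wC|w [wA _]].
  by split => j _ //=; case: eqP => [->|].
by have := wA i; rewrite /= im eqxx; exact.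
Qed.

Lemma measurable_wait_past m n i : (i < n)%N ->
  measurable_fun setT (e i : past m n -> R).
Proof.
move=> im _ C mC; rewrite setTI; apply: sub_sigma_algebra.
exists (fun=> setT), (fun j => if j == i then C else setT); split => //.
  by move=> j; case: ifP.
rewrite /cylinder !set_iota; apply/seteqP; split => [w wC|w [_ wA]].
  by split => j _ //=; case: eqP => [->|].
by have := wA i; rewrite /= im eqxx; exact.
Qed.

(* The signs and waiting times have the right values only up to null sets;
   these versions have them everywhere. *)
Definition sign_of (v : R) : R := if v == 1 then 1 else -1.
Definition signs (w : T) (i : nat) : R := sign_of (theta i w).
Definition waits (w : T) (i : nat) : R := Num.max 0 (e i w).

Lemma sign_of_bound v : `|sign_of v| <= 1.
Proof. by rewrite /sign_of; case: ifP; rewrite ?normrN normr1. Qed.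

Lemma bounded_measurable_sign_of : bounded_measurable (sign_of : R -> R).
Proof.
split; last by exists 1; exact: sign_of_bound.
apply: measurable_fun_ifT => //.
exact: (measurable_fun_eqr (f := id) (g := cst 1)).
Qed.

Lemma waits_ge0 w i : 0 <= waits w i. Proof. by rewrite /waits le_max lexx. Qed.

Section measurability.
Variables (t : R) (n : nat) (dU : measure_display) (U : measurableType dU).
Variables (s x : U -> nat -> R).
Hypotheses (ms : forall i, (i < n)%N -> measurable_fun setT (s^~ i)).
Hypotheses (mx : forall i, (i < n)%N -> measurable_fun setT (x^~ i)).

(** The space [U] is arbitrary because it stands both for a past sigma-algebra and for the product
    of such a past with the line on which the next wait lives. *)
Lemma measurable_arrival_time k : (k <= n)%N ->
  measurable_fun setT (fun w => arrival_time (x w) k).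
Proof.
elim: k => [_|k IH kn]; first rewrite (_ : (fun w => _) = cst 0)//.
  by apply/funext => w; rewrite arrival_time0.
under eq_fun do rewrite arrival_timeS.
by apply: measurable_funD; [exact/IH/ltnW|exact: mx].
Qed.

Lemma measurable_stopped_displacement k : (k <= n)%N ->
  measurable_fun setT (fun w => stopped_displacement t (s w) (x w) k).
Proof.
elim: k => [_|k IH kn].
  rewrite (_ : (fun w => _) = cst 0)//.
  by apply/funext => w; rewrite /stopped_displacement big_ord0.
under eq_fun do rewrite stopped_displacementS.
apply: measurable_funD; first exact/IH/ltnW.
apply: measurable_funM; first exact: ms.
apply: measurable_minr; first exact: mx.
apply: measurable_maxr => //; apply: measurable_funB => //.
exact/measurable_arrival_time/ltnW.
Qed.

Lemma measurable_stopped_velocity k : (k <= n)%N ->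
  measurable_fun setT (fun w => stopped_velocity t (s w) (x w) k).
Proof.
elim: k => [_|k IH kn]; first rewrite (_ : (fun w => _) = cst 0)//.
  by apply/funext => w; rewrite /stopped_velocity big_ord0.
under eq_fun do rewrite stopped_velocityS.
apply: measurable_funD; first exact/IH/ltnW.
apply: measurable_funM; first exact: ms.
have mk : measurable_fun setT (fun w => arrival_time (x w) k).
  exact/measurable_arrival_time/ltnW.
have -> : (fun w => ((arrival_time (x w) k <= t) &&
      (t < arrival_time (x w) k + x w k))%R%:R) =
    (fun w => if (arrival_time (x w) k <= t) && (t < arrival_time (x w) k + x w k)
      then 1 else 0 : R).
  by apply/funext => w; case: (_ && _).
apply: measurable_fun_ifT => //; apply: measurable_and.
  exact: measurable_fun_ler.
by apply: measurable_fun_ltr => //; apply: measurable_funD => //; exact: mx.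
Qed.

End measurability.
End telegraph_martingale.

(** * The exponential weight along the arrivals *)

Section telegraph_weight.
Context {R : realType}.
Variables (t mu y rate : R).
Hypotheses (t0 : 0 <= t) (mu0 : 0 < mu) (rate0 : 0 < rate).
Hypothesis y_root : mu * y ^+ 2 - rate * y - mu = 0.

(** The process [exp (mu Z + mu y s) (1 - y Xi)] observed at [s = Num.min (arrival_time x n) t].
    Before [t] is passed the velocity is 0, so the last factor is 1 until the terminal sign is
    known. *)
Definition telegraph_weight (n : nat) (s x : nat -> R) : R :=
  expR (mu * stopped_displacement t s x n
        + mu * y * Num.min (arrival_time x n) t)
  * (1 - y * stopped_velocity t s x n).

Lemma telegraph_weight_bound n s x : (forall i, 0 <= x i) ->
  (forall i, `|s i| <= 1) ->
  `|telegraph_weight n s x| <= expR (mu * t + `|mu * y| * t) * (1 + `|y|).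
Proof.
move=> x0 s1; rewrite normrM; apply: ler_pM => //.
  rewrite ger0_norm ?expR_ge0// ler_expR; apply: lerD.
    rewrite ler_wpM2l ?(ltW mu0)//.
    exact: le_trans (ler_norm _) (stopped_displacement_le t0 x0 s1 n).
  apply: (le_trans (ler_norm _)); rewrite normrM ler_wpM2l//.
  by rewrite ger0_norm ?ge_min ?lexx ?orbT// le_min t0 arrival_time_ge0.
apply: (le_trans (ler_normB _ _)); rewrite normr1 lerD2l normrM ler_piMr//.
exact: stopped_velocity_bound.
Qed.

Lemma measurable_telegraph_weight dU (U : measurableType dU) (s x : U -> nat -> R) n :
  (forall i, (i < n)%N -> measurable_fun setT (s^~ i)) ->
  (forall i, (i < n)%N -> measurable_fun setT (x^~ i)) ->
  measurable_fun setT (fun w => telegraph_weight n (s w) (x w)).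
Proof.
move=> ms mx; apply: measurable_funM.
  apply: measurableT_comp => //; apply: measurable_funD.
    by apply: measurable_funM => //; exact: (measurable_stopped_displacement t ms mx (leqnn n)).
  apply: measurable_funM => //; apply: measurable_minr => //.
  exact: (measurable_arrival_time mx (leqnn n)).
apply: measurable_funB => //; apply: measurable_funM => //.
exact: (measurable_stopped_velocity t ms mx (leqnn n)).
Qed.

(** If the arrival time already exceeds [t], the next wait changes nothing. Otherwise the wait is
    one exponential step with growth rate [al = mu * s n + mu * y] and jump coefficient
    [c = y * s n]; the compensation condition [c * (al - rate) = al] is the quadratic equation for
    [y], since [s n] has square 1. *)
Lemma Rintegral_telegraph_weight (nu : probability (measurableTypeR R) R) n s x :
  (forall z : R, 0 <= z -> nu `]z, +oo[%classic = (expR (- (rate * z)))%:E) ->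
  (forall i, 0 <= x i) -> s n = 1 \/ s n = - 1 ->
  \int[nu]_v telegraph_weight n.+1 s (fun i => if i == n then Num.max 0 v else x i)
  = telegraph_weight n s x * (1 - y * s n * (arrival_time x n <= t)%R%:R).
Proof.
move=> nu_tail x0 sn.
pose xv v i : R := if i == n then Num.max 0 v else x i.
have xvE v i : (i < n)%N -> xv v i = x i by move=> ni; rewrite /xv ltn_eqF.
have TE v i : (i <= n)%N -> arrival_time (xv v) i = arrival_time x i.
  by move=> ni; apply: eq_bigr => j _; rewrite xvE// (leq_trans (ltn_ord j)).
have xvn v : xv v n = Num.max 0 v by rewrite /xv eqxx.
have DE v : stopped_displacement t s (xv v) n = stopped_displacement t s x n.
  by apply: eq_bigr => j _; rewrite xvE// TE// ltnW.
have VE v : stopped_velocity t s (xv v) n = stopped_velocity t s x n.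
  by apply: eq_bigr => j _; rewrite !TE// ltnW.
have xv0 v i : 0 <= xv v i by rewrite /xv; case: ifP => _ //; rewrite le_max lexx.
have WE v : telegraph_weight n.+1 s (xv v) =
  expR (mu * (stopped_displacement t s x n + s n *
          Num.min (Num.max 0 v) (Num.max 0 (t - arrival_time x n)))
      + mu * y * (Num.min (arrival_time x n) t +
          Num.min (Num.max 0 v) (Num.max 0 (t - arrival_time x n))))
  * (1 - y * (stopped_velocity t s x n + s n *
      ((arrival_time x n <= t) && (t < arrival_time x n + Num.max 0 v))%R%:R)).
  rewrite /telegraph_weight stopped_displacementS stopped_velocityS.
  by rewrite arrival_timeS (min_arrival_timeS t (xv0 v)) DE VE TE// xvn.
have := arrival_time_ge0 x0 n; set a := arrival_time x n in WE *.
move=> a0; under eq_Rintegral do rewrite -/(xv _) WE.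
have [ta|ta] := lerP a t; last first.
  rewrite [Num.max 0 (t - a)]max_l; last by rewrite subr_le0 ltW.
  under eq_Rintegral => v _.
    have -> : Num.min (Num.max 0 v) 0 = 0 by rewrite min_r// le_max lexx.
    rewrite /= !mulr0 !addr0.
    over.
  rewrite Rintegral_prob_cst !mulr0 subr0 mulr1.
  by rewrite /telegraph_weight -/a (min_r (ltW ta)).
set u := Num.max 0 (t - a); have uE : u = t - a by rewrite /u max_r// subr_ge0.
have u0 : 0 <= u by rewrite uE subr_ge0.
pose c := y * s n; pose al := mu * s n + mu * y.
have s2 : s n ^+ 2 = 1 by case: sn => ->; rewrite ?sqrrN expr1n.
have cal : c * (al - rate) = al.
  rewrite /c /al; transitivity (mu * y * s n ^+ 2 + s n * (mu * y ^+ 2 - rate * y)).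
    by ring.
  have -> : mu * y ^+ 2 - rate * y = mu by apply/eqP; rewrite -subr_eq0 y_root.
  by rewrite s2; ring.
have al_rate : al != rate.
  apply/eqP => h; move: cal; rewrite h subrr mulr0 => h2.
  by move: rate0; rewrite -h2 ltxx.
have vel0 : stopped_velocity t s x n = 0 by exact: stopped_velocity_before.
have fE v : expR (mu * (stopped_displacement t s x n + s n * Num.min (Num.max 0 v) u)
      + mu * y * (a + Num.min (Num.max 0 v) u)) *
     (1 - y * (stopped_velocity t s x n + s n * (true && (t < a + Num.max 0 v))%R%:R))
   = telegraph_weight n s x *
     (expR (al * Num.min (Num.max 0 v) u) * (1 - c * (u < Num.max 0 v)%R%:R)).
  rewrite /telegraph_weight -/a (min_l ta) vel0 mulr0 subr0 mulr1 add0r /= mulrA -expRD.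
  rewrite uE ltrBlDl /c /al; congr (expR _ * _); last by ring.
  by ring.
under eq_Rintegral do rewrite fE.
rewrite RintegralZl//; last first.
  apply: bounded_measurable_integrable; exact: bounded_measurable_step.
by rewrite (Rintegral_exponential_step rate0 nu_tail u0 al_rate cal) mulr1.
Qed.

End telegraph_weight.

Section telegraph_identity.
Context {d} {T : measurableType d} {R : realType} (P : probability T R).
Variables (rate t : R) (theta e : nat -> {RV P >-> R}).
Hypotheses (rate0 : 0 < rate) (t0 : 0 <= t).
Hypothesis tel : is_telegraph_data rate theta e.

Local Notation past m n := (g_sigma_algebraType (cylinders theta e m n)).
Local Notation S := (signs theta).
Local Notation X := (waits e).

Let S1 w i : `|S w i| <= 1. Proof. exact: sign_of_bound. Qed.
Let X0 w i : 0 <= X w i. Proof. exact: waits_ge0. Qed.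

Let mS m n i : (i < m)%N -> measurable_fun setT (S^~ i : past m n -> R).
Proof.
move=> im; apply: (measurableT_comp (f := sign_of)).
  by case: (@bounded_measurable_sign_of R).
exact: measurable_sign_past.
Qed.

Let mX m n i : (i < n)%N -> measurable_fun setT (X^~ i : past m n -> R).
Proof.
by move=> im; apply: measurable_maxr => //; exact: measurable_wait_past.
Qed.

(* [R] and [measurableTypeR R] have the same measurable sets but different
   displays; the measures built from Lebesgue measure need the second. *)
Definition measurableTypeR_RV (Z : {RV P >-> R}) : {RV P >-> measurableTypeR R} :=
  mfun_of (U := measurableTypeR R) (measurable_funPT Z).

Lemma wait_law n (z : R) : 0 <= z ->
  distribution P (measurableTypeR_RV (e n)) `]z, +oo[%classic = (expR (- (rate * z)))%:E.
Proof.
move=> z0; rewrite -(telegraph_wait_tail tel n z0) /distribution /pushforward.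
by congr (P _); apply/seteqP; split => w /=; rewrite in_itv /= andbT.
Qed.

Lemma sign_mean n : \int[distribution P (measurableTypeR_RV (theta n))]_v sign_of v = 0.
Proof.
have ms := @bounded_measurable_sign_of R.
have mA : measurable [set w | theta n w = 1] by exact: (measurable_funPTI (theta n) (measurable_set1 1)).
rewrite Rintegral_distribution//.
have -> : (fun w => sign_of (theta n w)) =
    (fun w => 2 * \1_[set w | theta n w = 1] w - 1).
  apply/funext => w; rewrite /sign_of indicE.
  case: eqP => h; first by rewrite mem_set// mulr1; lra.
  by rewrite memNset// mulr0; lra.
have b1 : bounded_measurable (\1_[set w | theta n w = 1] : T -> R).
  exact: bounded_measurable_indic.
have b2 : bounded_measurable (fun w => 2 * \1_[set w | theta n w = 1] w : R).
  by apply: bounded_measurableM => //; exact: bounded_measurable_cst.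
rewrite RintegralB//; last 2 first.
- exact: bounded_measurable_integrable.
- by apply: bounded_measurable_integrable; exact: bounded_measurable_cst.
rewrite Rintegral_prob_cst RintegralZl//; last exact: bounded_measurable_integrable.
have -> : \int[P]_w \1_[set w | theta n w = 1] w = 1 / 2.
  rewrite /Rintegral integral_indic// setIT.
  exact: (congr1 fine (telegraph_sign_pos tel n)).
by lra.
Qed.

Section martingale.
Variables (mu y : R).
Hypotheses (mu0 : 0 < mu) (y_root : mu * y ^+ 2 - rate * y - mu = 0).

Let V n w := telegraph_weight t mu y n (S w) (X w).

Let K := expR (mu * t + `|mu * y| * t) * (1 + `|y|).

Let V_bound n w : `|V n w| <= K.
Proof. exact: telegraph_weight_bound. Qed.

Let mV m n k : (n <= m)%N -> (n <= k)%N -> measurable_fun setT (V n : past m k -> R).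
Proof.
move=> nm nk; apply: measurable_telegraph_weight => i ni.
  by apply: mS; exact: leq_trans ni nm.
by apply: mX; exact: leq_trans ni nk.
Qed.

Let sub_cyl m n : cylinders theta e m n `<=` measurable.
Proof. exact: cylinders_measurable. Qed.

Let bV n : bounded_measurable (V n).
Proof.
apply: (bounded_measurable_g_sigma_algebra (@sub_cyl n n)).
by split; [exact: mV|exists K; exact: V_bound].
Qed.

Let ind n w : R := (arrival_time (X w) n <= t)%R%:R.

Let b_ind m n : bounded_measurable (ind n : past m n -> R).
Proof.
split; last by exists 1 => w; rewrite /ind normr_nat lern1 leq_b1.
rewrite (_ : ind n = fun w => if arrival_time (X w) n <= t then 1 else 0); last first.
  by apply/funext => w; rewrite /ind; case: ifP.
apply: measurable_fun_ifT => //; apply: measurable_fun_ler => //.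
exact: (measurable_arrival_time (fun i => @mX m n i) (leqnn n)).
Qed.

(** The wait of index [n] is integrated out while the sign of the same index counts as past, hence
    the asymmetric [past n.+1 n]. What remains is a factor that is affine in that sign. *)
Let wait_step n :
  \int[P]_w V n.+1 w = \int[P]_w (V n w * (1 - y * S w n * ind n w)).
Proof.
pose xv (z : past n.+1 n * measurableTypeR R) (i : nat) : R :=
  if i == n then Num.max 0 z.2 else X z.1 i.
pose f (z : past n.+1 n * measurableTypeR R) :=
  telegraph_weight t mu y n.+1 (S z.1) (xv z).
have bf : bounded_measurable f.
  split.
    apply: measurable_telegraph_weight => i ni.
      apply: (measurableT_comp (f := S^~ i : past n.+1 n -> R) _ measurable_fst).
      exact: mS.
    have [->|/eqP ni'] := eqVneq i n.
      rewrite /xv eqxx; apply: measurable_maxr => //; exact: measurable_snd.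
    rewrite /xv (introF eqP)//.
    apply: (measurableT_comp (f := X^~ i : past n.+1 n -> R) _ measurable_fst).
    by apply: mX; rewrite ltn_neqAle -ltnS ni andbT; exact/eqP.
  exists K => z; apply: telegraph_weight_bound => // i.
  by rewrite /xv; case: ifP => _ //; rewrite le_max lexx.
transitivity (\int[P]_w f (w, e n w)).
  apply: eq_Rintegral => w _; rewrite /f /V; congr (telegraph_weight _ _ _ _ _ _).
  by apply/funext => i; rewrite /xv /=; case: eqP => [->|].
rewrite (freezing (G := cylinders theta e n.+1 n) (W := measurableTypeR_RV (e n))) //; first last.
- exact: (indep_wait tel).
- exact: cylindersT.
- exact: cylindersI.
apply: eq_Rintegral => w _; rewrite /f /xv /=.
rewrite (Rintegral_telegraph_weight t rate0 y_root)//.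
- by move=> z z0; exact: wait_law.
- by rewrite /signs /sign_of; case: ifP; [left|right].
Qed.

(** The remaining factor is averaged over the sign of index [n], which is centred and independent of
    the first [n] signs and waits. *)
Let sign_step n :
  \int[P]_w (V n w * (1 - y * S w n * ind n w)) = \int[P]_w V n w.
Proof.
pose f (z : past n n * measurableTypeR R) :=
  V n z.1 * (1 - y * sign_of z.2 * ind n z.1).
have bV' : bounded_measurable (V n : past n n -> R).
  by split; [exact: mV|exists K; exact: V_bound].
have bs := @bounded_measurable_sign_of R.
have bf : bounded_measurable f.
  apply: bounded_measurableM; first exact: (bounded_measurable_comp measurable_fst).
  apply: bounded_measurableB; first exact: bounded_measurable_cst.
  apply: bounded_measurableM.
    apply: bounded_measurableM; first exact: bounded_measurable_cst.
    exact: (bounded_measurable_comp measurable_snd).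
  exact: (bounded_measurable_comp measurable_fst (b_ind n n)).
transitivity (\int[P]_w f (w, theta n w)); first by [].
rewrite (freezing (G := cylinders theta e n n) (W := measurableTypeR_RV (theta n))) //; first last.
- exact: (indep_sign tel).
- exact: cylindersT.
- exact: cylindersI.
apply: eq_Rintegral => w _; rewrite /f /=.
have -> : (fun v => V n w * (1 - y * sign_of v * ind n w)) =
    (fun v => V n w - V n w * y * ind n w * sign_of v).
  by apply/funext => v; ring.
rewrite RintegralB//; last 2 first.
- by apply: bounded_measurable_integrable; exact: bounded_measurable_cst.
- apply: (bounded_measurable_integrable (distribution P (measurableTypeR_RV (theta n)))).
  by apply: bounded_measurableM => //; exact: bounded_measurable_cst.
rewrite Rintegral_prob_cst RintegralZl//; last exact: bounded_measurable_integrable.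
by rewrite sign_mean mulr0 subr0.
Qed.

Lemma telegraph_weight_mean n :
  \int[P]_w telegraph_weight t mu y n (S w) (X w) = 1.
Proof.
elim: n => [|n IH]; last by rewrite -/(V n.+1 _) wait_step sign_step.
rewrite -[RHS](Rintegral_prob_cst P); apply: eq_Rintegral => w _.
rewrite /telegraph_weight /stopped_displacement /stopped_velocity !big_ord0.
by rewrite arrival_time0 min_l// !mulr0 subr0 addr0 expR0 mulr1.
Qed.

End martingale.

Lemma ae_signs : {ae P, forall w, forall i, S w i = theta i w}.
Proof.
apply/ae_foralln => i.
have m1 (c : R) : measurable [set w | theta i w = c].
  exact: (measurable_funPTI (theta i) (measurable_set1 c)).
have : P ([set w | theta i w = 1] `|` [set w | theta i w = -1]) = 1%E.
  rewrite measureU//.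
    transitivity ((1 / 2)%:E + (1 / 2)%:E : \bar R)%E; last by rewrite -EFinD; congr EFin; lra.
    congr (_ + _)%E; first exact: (telegraph_sign_pos tel i).
    exact: (telegraph_sign_neg tel i).
  by apply/seteqP; split => // w /= [-> h]; exfalso; move: h; lra.
move=> /probability1_ae h; have {}h := h (measurableU _ _ (m1 1) (m1 (-1))).
apply: filterS h => w; rewrite /signs /sign_of => -[]/= ->; first by rewrite eqxx.
by case: eqP => //; lra.
Qed.

Lemma ae_waits_gt0 : {ae P, forall w, forall i, 0 < e i w}.
Proof.
apply/ae_foralln => i; apply: (@probability1_ae _ _ _ P [set w | 0 < e i w]).
  have := measurable_funPTI (e i) (measurable_itv `]0, +oo[).
  congr measurable; apply/seteqP; split => w /=; rewrite in_itv /= andbT//.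
by rewrite (telegraph_wait_tail tel)// mulr0 oppr0 expR0.
Qed.

(** Each wait is at most [t] with the same probability [q < 1], so by independence the first [n]
    waits all are with probability [q ^+ n]. A single wait above [t] is enough for the arrival times
    to pass [t]. *)
Lemma ae_wait_large : {ae P, forall w, exists i, t < e i w}.
Proof.
pose N := \bigcap_i (e i @^-1` `]-oo, t]%classic).
have mN : measurable N.
  by apply: bigcap_measurable => // i _; exact: measurable_funPTI.
exists N; split => //; last first.
  move=> w /= h i _ /=; rewrite in_itv /= leNgt; apply/negP => it.
  by apply: h; exists i.
pose q := 1 - expR (- (rate * t)).
have q01 : 0 <= q < 1.
  rewrite /q subr_ge0 -[leRHS]expR0 ler_expR oppr_le0 mulr_ge0 ?(ltW rate0)//=.
  by rewrite ltrBlDr ltrDl expR_gt0.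
have le_q n : (P N <= (q ^+ n)%:E)%E.
  have -> : (q ^+ n)%:E = P (\bigcap_(i in [set` iota 0 n]) e i @^-1` `]-oo, t]%classic).
    rewrite (telegraph_wait_indep tel) ?iota_uniq//.
    have Pi i : P (e i @^-1` `]-oo, t]%classic) = q%:E.
      have -> : e i @^-1` `]-oo, t]%classic = ~` [set w | t < e i w].
        by apply/seteqP; split => w /=; rewrite in_itv /= leNgt => /negP.
      rewrite probability_setC ?(telegraph_wait_tail tel)//.
      have := measurable_funPTI (e i) (measurable_itv `]t, +oo[).
      by congr measurable; apply/seteqP; split => w /=; rewrite in_itv /= andbT.
    under eq_bigr do rewrite Pi.
    by elim: n => [|n IH]; [rewrite big_nil|rewrite -addn1 iotaD big_cat big_seq1 /= -IH -EFinM -exprSr addn1].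
  apply: le_measure; rewrite ?inE//.
    by apply: fin_bigcap_measurable; [exact: finite_seq|move=> i _; exact: measurable_funPTI].
  by move=> w wN i _; exact: wN.
apply/eqP; rewrite -measure_le0.
have cq : (q ^+ n)%:E @[n --> \oo] --> (0%R)%:E.
  apply: cvg_EFin; first exact: nearW.
  by apply: cvg_expr; rewrite ger0_norm; case/andP: q01.
by apply: (cvge_to_ge cq); exact: nearW.
Qed.

Lemma ae_telegraph_limit : {ae P, forall w, exists k, forall n, (k < n)%N ->
  [/\ stopped_displacement t (S w) (X w) n =
        telegraph (fun i => theta i w) (fun i => e i w) t,
      stopped_velocity t (S w) (X w) n = S w (arrival_count (X w) t) &
      Num.min (arrival_time (X w) n) t = t]}.
Proof.
apply: filterS3 ae_signs ae_waits_gt0 ae_wait_large => w sw xw [m tm].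
have XE : X w = fun i => e i w by apply/funext => i; rewrite /waits max_r// ltW.
have SE : S w = fun i => theta i w by apply/funext => i; exact: sw.
have Xpos i : 0 < X w i by rewrite XE.
have tX : t < arrival_time (X w) m.+1.
  rewrite arrival_timeS XE (lt_le_trans tm)// lerDr -XE.
  by apply: arrival_time_ge0 => i; exact: ltW.
exists (arrival_count (X w) t) => n kn.
by rewrite (stopped_displacementE _ t0 Xpos tX)// (stopped_velocityE _ t0 Xpos tX)//
   (min_arrival_timeE t0 Xpos tX)// XE SE.
Qed.

(** On almost every path the weight is constant from some index on, so bounded convergence carries
    its mean 1 to the limit, where the velocity is the sign of the interval that contains [t]. *)
Lemma telegraph_identity : exists Y Xi : {RV P >-> R},
  [/\ {ae P, forall w, telegraph (fun i => theta i w) (fun i => e i w) t = Y w},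
      (forall w, `|Y w| <= t), (forall w, `|Xi w| <= 1) &
      forall mu y, 0 < mu -> mu * y ^+ 2 - rate * y - mu = 0 ->
        \int[P]_w (expR (mu * Y w + mu * y * t) * (1 - y * Xi w)) = 1].
Proof.
have mD n : measurable_fun setT (fun w => stopped_displacement t (S w) (X w) n).
  apply: (@measurable_fun_g_sigma_algebra _ _ _ _ (cylinders theta e n n)).
    exact: cylinders_measurable.
  exact: (measurable_stopped_displacement t (fun i => @mS n n i) (fun i => @mX n n i) (leqnn n)).
have mVel n : measurable_fun setT (fun w => stopped_velocity t (S w) (X w) n).
  apply: (@measurable_fun_g_sigma_algebra _ _ _ _ (cylinders theta e n n)).
    exact: cylinders_measurable.
  exact: (measurable_stopped_velocity t (fun i => @mS n n i) (fun i => @mX n n i) (leqnn n)).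
have [|Y [Yt YE]] := ae_limit_version_bounded (P := P)
    (x := fun w => telegraph (fun i => theta i w) (fun i => e i w) t) t0 mD
    (fun n w => stopped_displacement_le t0 (X0 w) (S1 w) n).
  apply: filterS ae_telegraph_limit => w [k kE]; apply: cvg_near_cst.
  by apply: filterS (nbhs_infty_gt k) => n /kE[].
have [|Xi [Xi1 XiE]] := ae_limit_version_bounded (P := P)
    (x := fun w => S w (arrival_count (X w) t)) ler01 mVel
    (fun n w => stopped_velocity_bound t (X0 w) (S1 w) n).
  apply: filterS ae_telegraph_limit => w [k kE]; apply: cvg_near_cst.
  by apply: filterS (nbhs_infty_gt k) => n /kE[].
exists Y, Xi; split => // mu y mu0 y_root.
have cv : (\int[P]_w telegraph_weight t mu y n (S w) (X w)) @[n --> \oo] -->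
    \int[P]_w (expR (mu * Y w + mu * y * t) * (1 - y * Xi w)).
  apply: (@bounded_convergence _ _ _ P _ _ (expR (mu * t + `|mu * y| * t) * (1 + `|y|))).
  - move=> n; apply: (@measurable_fun_g_sigma_algebra _ _ _ _ (cylinders theta e n n)).
      exact: cylinders_measurable.
    by apply: measurable_telegraph_weight => i; [exact: mS|exact: mX].
  - apply: measurable_funM.
      apply: measurableT_comp => //; apply: measurable_funD => //.
      exact: measurable_funM.
    by apply: measurable_funB => //; exact: measurable_funM.
  - by move=> n w; exact: telegraph_weight_bound.
  - apply: filterS3 ae_telegraph_limit YE XiE => w [k kE] YEw XiEw.
    apply: cvg_near_cst; apply: filterS (nbhs_infty_gt k) => n kn.
    by have [h1 h2 h3] := kE n kn; rewrite /telegraph_weight h1 h2 h3 YEw XiEw.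
apply: (cvg_unique _ cv) => //; apply: cvg_near_cst; apply: nearW => n.
exact: telegraph_weight_mean.
Qed.

End telegraph_identity.

(** * Reflected paths *)

Section continuous_paths.
Context {R : realType}.
Implicit Types (y z : R -> R) (L eps : R).

Lemma continuous_pathP y : continuous_path y -> forall p, 0 <= p ->
  forall eps, 0 < eps -> exists2 r, 0 < r &
    forall u, 0 <= u -> `|p - u| < r -> `|y p - y u| <= eps.
Proof.
move=> /subspace_continuousP cy p p0 eps eps0.
have Ap : `[0, +oo[%classic p by rewrite /= in_itv /= p0.
have := cy p Ap; move=> /cvgrPdist_le /(_ eps eps0).
rewrite near_withinE => /nbhs_ballP[r /= r0 h]; exists r => // u u0 pu.
by apply: h => //=; rewrite in_itv /= u0.
Qed.

Lemma continuous_pathD y z : continuous_path y -> continuous_path z ->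
  continuous_path (fun s => y s + z s).
Proof. by move=> cy cz u; apply: cvgD; [exact: cy|exact: cz]. Qed.

Lemma continuous_pathM y z : continuous_path y -> continuous_path z ->
  continuous_path (fun s => y s * z s).
Proof. by move=> cy cz u; apply: cvgM; [exact: cy|exact: cz]. Qed.

Lemma continuous_path_cst (k : R) : continuous_path (fun=> k).
Proof. by move=> u; exact: cvg_cst. Qed.

Lemma continuous_path_expR y : continuous_path y ->
  continuous_path (fun s => expR (y s)).
Proof.
by move=> cy u; apply: (cvg_comp y expR); [exact: cy|exact: continuous_expR].
Qed.

(** Heine's theorem on [[0, L]], with compactness used in its near-covering form: the covering
    parameter is the modulus [r]. *)
Lemma uniform_continuous_path y L eps : continuous_path y -> 0 < eps ->
  exists2 r, 0 < r & forall s u, 0 <= s <= L -> 0 <= u <= L ->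
    `|s - u| < r -> `|y s - y u| <= eps.
Proof.
move=> cy eps0; have e2 : 0 < eps / 2 by rewrite divr_gt0.
have := @segment_compact R 0 L => /compact_near_coveringP.
move=> /(_ R (0^'+)%R (fun r s => 0 <= s ->
   forall u, 0 <= u <= L -> `|s - u| < r -> `|y s - y u| <= eps) _)[].
- move=> x; rewrite /= in_itv /= => /andP[x0 xL].
  have [r r0 hr] := continuous_pathP cy x0 e2.
  have r20 : 0 < r / 2 by rewrite divr_gt0.
  near=> s delta => s0 u /andP[u0 uL] su.
  have xs : `|x - s| < r / 2.
    by near: s; apply: nbhsx_ballx.
  have dr : delta < r / 2 by near: delta; exact: nbhs_right_lt.
  have xu : `|x - u| < r.
    rewrite (_ : x - u = (x - s) + (s - u)); last by ring.
    apply: (le_lt_trans (ler_normD _ _)); rewrite [ltRHS]splitr.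
    exact: ltrD xs (lt_trans su dr).
  have h1 := hr u u0 xu; have h2 : `|y x - y s| <= eps / 2.
    by apply: hr => //; apply: (lt_trans xs); rewrite ltr_pdivrMr// ltr_pMr// ltr1n.
  rewrite (_ : y s - y u = (y x - y u) - (y x - y s)); last by ring.
  by apply: (le_trans (ler_normB _ _)); rewrite [leRHS]splitr; apply: lerD.
- move=> r /= r0 h; exists (r / 2); first by rewrite divr_gt0.
  move=> s u /andP[s0 sL] uL su.
  apply: (h (r / 2)) => //=.
  + by rewrite sub0r normrN gtr0_norm ?divr_gt0// ltr_pdivrMr// ltr_pMr// ltr1n.
  + by rewrite divr_gt0.
  + by rewrite in_itv /= s0 sL.
Unshelve. all: by end_near. Qed.

End continuous_paths.

(** * Grid sums stopped when a monotone clock passes a level *)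

Section stopped_sums.
Context {R : realType}.
Variables (G : R -> R) (t L rho : R).
Hypotheses (G_mono : forall s u, 0 <= s -> s <= u -> G s <= G u) (L0 : 0 < L).
Hypotheses (rho0 : 0 <= rho) (rhoL : rho <= L).
Hypothesis G_before : forall s, 0 <= s -> s < rho -> G s <= t.
Hypothesis G_after : forall s, rho < s -> s <= L -> t < G s.

(** Sums use this indicator at the left end of a grid interval, where it is already known; this
    keeps the coefficients predictable. *)
Definition alive (s : R) : R := (G s <= t)%R%:R.

(** Since the clock is monotone, the indicators are 1 up to some index [k] and 0 afterwards, so the
    sum telescopes to an increment of [v] over the first [k] steps. *)
Lemma stopped_sum_telescope (v : nat -> R) (g : nat -> R) (m : nat) :
  {homo g : i j / (i <= j)%N >-> i <= j} ->
  exists k, [/\ (k <= m)%N, (forall i, (i < k)%N -> g i <= t),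
    ((k < m)%N -> t < g k) &
    \sum_(i < m) (g i <= t)%R%:R * (v i.+1 - v i) = v k - v 0%N].
Proof.
move=> g_mono; elim: m => [|m [k [km gk kg IH]]].
  by exists 0%N; split => //; rewrite big_ord0 subrr.
rewrite big_ord_recr /= IH.
move: km; rewrite leq_eqVlt => /predU1P[km|km].
  subst k; have [gm|gm] := lerP (g m) t.
    exists m.+1; split => //.
    - by move=> i; rewrite ltnS leq_eqVlt => /predU1P[->//|/gk].
    - by rewrite ltnn.
    - by rewrite mul1r; ring.
  by exists m; split => //; rewrite mul0r addr0.
have := kg km => tk; exists k; split => //; first exact: (leqW (ltnW km)).
by rewrite [_ <= t]leNgt (lt_le_trans tk (g_mono _ _ (ltnW km))) mul0r addr0.
Qed.

Definition mesh (n : nat) : R := L / n.+1%:R.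
Definition grid (n i : nat) : R := i%:R * mesh n.

Lemma mesh_gt0 n : 0 < mesh n. Proof. by rewrite /mesh divr_gt0. Qed.

Lemma grid_end n : grid n n.+1 = L.
Proof. by rewrite /grid /mesh mulrC divfK. Qed.

Lemma grid_ge0 n i : 0 <= grid n i.
Proof. by rewrite /grid mulr_ge0// ltW// mesh_gt0. Qed.

Lemma le_grid n i j : (i <= j)%N -> grid n i <= grid n j.
Proof. by move=> ij; rewrite /grid ler_wpM2r ?ler_nat// ltW// mesh_gt0. Qed.

Lemma grid_le n i : (i <= n.+1)%N -> grid n i <= L.
Proof. by move=> ni; rewrite -(grid_end n) le_grid. Qed.

Lemma gridS n i : grid n i.+1 = grid n i + mesh n.
Proof. by rewrite /grid -natr1 mulrDl mul1r. Qed.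

Lemma near_mesh (r : R) : 0 < r -> \forall n \near \oo, mesh n < r.
Proof.
move=> r0; near=> n; rewrite /mesh ltr_pdivrMr// mulrC -ltr_pdivrMr//.
apply: (@le_lt_trans _ _ n%:R); last by rewrite ltr_nat ltnSn.
by near: n; exact: nbhs_infty_ger.
Unshelve. all: by end_near. Qed.

(** The clock is at most [t] before [rho] and above [t] after it, so the stopping index cannot be
    more than one mesh away from [rho]. If the clock never stops the sum, [k] is the end of the grid
    and [rhoL] takes over. *)
Lemma grid_stop n k : (k <= n.+1)%N ->
  (forall i, (i < k)%N -> G (grid n i) <= t) ->
  ((k < n.+1)%N -> t < G (grid n k)) -> `|rho - grid n k| <= mesh n.
Proof.
move=> kn kt tk.
have hm : rho - mesh n < rho by rewrite ltrBlDr ltrDl mesh_gt0.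
have hp : rho < rho + mesh n by rewrite ltrDl mesh_gt0.
have h1 : rho - mesh n <= grid n k.
  rewrite leNgt; apply/negP => gk.
  move: kn; rewrite leq_eqVlt => /predU1P[kn|kn].
    by have := lt_trans gk (lt_le_trans hm rhoL); rewrite kn grid_end ltxx.
  have := tk kn; apply/negP; rewrite -leNgt; apply: G_before; first exact: grid_ge0.
  exact: lt_trans gk hm.
have h2 : grid n k <= rho + mesh n.
  rewrite leNgt; apply/negP => gk.
  case: k kn kt tk gk h1 => [|k] kn kt tk gk h1.
    by have := lt_trans (le_lt_trans rho0 hp) gk; rewrite /grid mul0r ltxx.
  have := kt k (ltnSn k); apply/negP; rewrite -ltNge; apply: G_after.
    by move: gk; rewrite gridS ltrD2r.
  by apply: grid_le; exact: ltnW.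
by rewrite ler_distlC h1 h2.
Qed.

Lemma stopped_sum_cvg (y : R -> R) : continuous_path y ->
  \sum_(i < n.+1) alive (grid n i) * (y (grid n i.+1) - y (grid n i))
    @[n --> \oo] --> y rho - y 0.
Proof.
move=> cy; apply/cvgrPdist_le => eps eps0.
have [r r0 hr] := continuous_pathP cy rho0 eps0.
near=> n.
have hn : mesh n < r by near: n; exact: near_mesh.
have [k [kn kt tk ->]] := @stopped_sum_telescope (y \o grid n) (G \o grid n) n.+1
  (fun i j ij => G_mono (grid_ge0 n i) (le_grid n ij)).
have -> : y rho - y 0 - ((y \o grid n) k - (y \o grid n) 0%N) = y rho - y (grid n k).
  by rewrite /= /grid mul0r; ring.
apply: hr; first exact: grid_ge0.
by apply: le_lt_trans hn; exact: grid_stop.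
Unshelve. all: by end_near. Qed.

End stopped_sums.

(** The lower bound is [1 + z <= expR z]. The upper one comes from [expR z * (1 - z) <= 1] and [(1 +
    z + 2 * z ^+ 2) * (1 - z) - 1 = z ^+ 2 * (1 - 2 * z)], which is nonnegative for [z <= 1 / 2]. *)
Lemma expR_sub_linear_bound {R : realType} (z : R) : `|z| <= 1 / 2 ->
  `|expR z - 1 - z| <= 2 * z ^+ 2.
Proof.
rewrite ler_norml => /andP[z1 z2].
have {}z1 : - (1 / 2) <= z := z1; have {}z2 : z <= 1 / 2 := z2.
have h1 := expR_ge1Dx z; have h2 := expR_ge1Dx (- z).
have e0 : 0 < expR z := expR_gt0 z.
have h3 : expR z * (1 - z) <= 1.
  by rewrite -[leRHS](mulfV (lt0r_neq0 e0)) -expRN ler_wpM2l// ltW.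
have h4 : expR z <= 1 + z + 2 * z ^+ 2.
  rewrite -(@ler_pM2r _ (1 - z)); last by lra.
  apply: (le_trans h3); rewrite -subr_ge0.
  rewrite (_ : _ - 1 = z ^+ 2 * (1 - 2 * z)); last by ring.
  by apply: mulr_ge0; [exact: sqr_ge0|lra].
by rewrite ger0_norm; lra.
Qed.

(** * Increments of the harmonic weight along a reflected path *)

Section reflected_path.
Context {R : realType}.
Variables (a b p q c : R) (x beta la lb : R -> R).
Hypothesis sk : skorokhod_path a b x beta la lb.
Hypothesis c_left : c = - (1 + c * a) * p.
Hypothesis c_right : c = (1 + c * b) * q.

Definition exp_local_time (s : R) : R := expR (p * la s + q * lb s).
(** Formally its differential is [psi] times [c dB + (p (1 + c a) + c) d la + (q (1 + c b) - c) d
    lb], because [la] grows only at [a] and [lb] only at [b]. The hypotheses [c_left] and [c_right]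
    say that both local time coefficients vanish. Being linear in [x], the weight has no
    second-order term. *)
Definition harmonic_weight (s : R) : R := exp_local_time s * (1 + c * x s).
Definition boundary_time (s : R) : R := la s + lb s.

Local Notation psi := exp_local_time.
Local Notation f := harmonic_weight.
Local Notation G := boundary_time.

Let la_mono s u : 0 <= s -> s <= u -> la s <= la u.
Proof. exact: (local_time_mono (skorokhod_left sk)). Qed.
Let lb_mono s u : 0 <= s -> s <= u -> lb s <= lb u.
Proof. exact: (local_time_mono (skorokhod_right sk)). Qed.
Let la0 : la 0 = 0. Proof. exact: (local_time_start (skorokhod_left sk)). Qed.
Let lb0 : lb 0 = 0. Proof. exact: (local_time_start (skorokhod_right sk)). Qed.

Lemma local_time_left_ge0 s : 0 <= s -> 0 <= la s.
Proof. by move=> s0; rewrite -la0 la_mono. Qed.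
Lemma local_time_right_ge0 s : 0 <= s -> 0 <= lb s.
Proof. by move=> s0; rewrite -lb0 lb_mono. Qed.

Lemma boundary_time_mono s u : 0 <= s -> s <= u -> G s <= G u.
Proof. by move=> s0 su; rewrite lerD ?la_mono ?lb_mono. Qed.

Lemma boundary_time0 : G 0 = 0. Proof. by rewrite /G la0 lb0 addr0. Qed.

Lemma harmonic_weight0 : f 0 = 1 + c * x 0.
Proof. by rewrite /f /psi la0 lb0 !mulr0 addr0 expR0 mul1r. Qed.

(* [x] visits [e] while [l] grows, so the increment of [l] is multiplied by the
   small factor [x u - e]. *)
Lemma local_time_increment_bound (l : R -> R) e s u eta :
  is_boundary_local_time x l e -> 0 <= s -> s <= u -> 0 <= eta ->
  (forall v, s <= v <= u -> `|x v - x u| <= eta) ->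
  `|(l u - l s) * (x u - e)| <= eta * (l u - l s).
Proof.
move=> lt s0 su eta0 osc.
have dl : 0 <= l u - l s by rewrite subr_ge0 (local_time_mono lt).
have [[v [vsu xv]]|no] := pselect (exists v, s <= v <= u /\ x v = e).
  rewrite normrM (ger0_norm dl) mulrC ler_wpM2r// -xv distrC; exact: osc.
rewrite (local_time_support lt s0 su) ?subrr ?mul0r ?normr0 ?mulr0//.
by move=> v vsu; apply/eqP => xv; apply: no; exists v.
Qed.

Lemma skorokhod_range_norm s : 0 <= s -> `|x s| <= `|a| + `|b|.
Proof.
move=> s0; have /andP[] := skorokhod_range sk s0.
have := ler_norm b; have := ler_norm (- a); rewrite normrN => h1 h2 h3 h4.
have h5 := normr_ge0 a; have h6 := normr_ge0 b.
by rewrite ler_norml; apply/andP; split; lra.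
Qed.

(** The first summand bounds the quadratic remainder of the exponential of the local times, the
    second the distance of [x u] from the boundary point at which a local time grew. *)
Let K : R := 2 * (`|p| + `|q|) ^+ 2 * (1 + `|c| * (`|a| + `|b|)) + (`|p| + `|q|) * `|c|.

Lemma transform_constant_ge0 : 0 <= K.
Proof. by rewrite /K addr_ge0 ?mulr_ge0 ?addr_ge0 ?sqr_ge0 ?mulr_ge0 ?addr_ge0. Qed.

(** Beyond the Brownian term, the increment consists of [expR z - 1 - z], quadratic in the local
    time increments, and of the terms [da * (x u - a)] and [db * (x u - b)], small by
    [local_time_increment_bound]. All are of order [eta] times the increment of the clock, hence
    summable with a small total. *)
Lemma harmonic_step s u eta : 0 <= s -> s <= u -> 0 <= eta ->
  (forall v, s <= v <= u -> `|x v - x u| <= eta) ->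
  G u - G s <= eta -> (`|p| + `|q|) * eta <= 1 / 2 ->
  `|f u - f s - c * psi s * (beta u - beta s)| <= psi s * (K * eta * (G u - G s)).
Proof.
move=> s0 su eta0 osc dG small.
have u0 : 0 <= u by exact: le_trans su.
pose da := la u - la s; pose db := lb u - lb s.
have da0 : 0 <= da by rewrite subr_ge0 la_mono.
have db0 : 0 <= db by rewrite subr_ge0 lb_mono.
have GE : G u - G s = da + db by rewrite /G /da /db; ring.
rewrite GE in dG *.
pose z := p * da + q * db.
have psiu : psi u = psi s * expR z.
  by rewrite /psi -expRD; congr expR; rewrite /z /da /db; ring.
have bE : beta u - beta s = x u - x s - da + db.
  by rewrite (skorokhod_decomp sk u0) (skorokhod_decomp sk s0) /da /db; ring.
have e1 : p * (1 + c * x u) + c = p * c * (x u - a).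
  by rewrite [X in _ + X]c_left; ring.
have e2 : q * (1 + c * x u) - c = q * c * (x u - b).
  by rewrite [X in _ - X]c_right; ring.
have -> : f u - f s - c * psi s * (beta u - beta s) =
    psi s * ((expR z - 1 - z) * (1 + c * x u) + (p * c * (da * (x u - a)) +
      q * c * (db * (x u - b)))).
  have -> : p * c * (da * (x u - a)) = da * (p * (1 + c * x u) + c) by rewrite e1; ring.
  have -> : q * c * (db * (x u - b)) = db * (q * (1 + c * x u) - c) by rewrite e2; ring.
  by rewrite /f psiu bE /z; ring.
have psi0 : 0 < psi s by exact: expR_gt0.
rewrite normrM (gtr0_norm psi0) ler_pM2l//.
have p0 := normr_ge0 p; have q0 := normr_ge0 q; have c0 := normr_ge0 c.
have dd0 : 0 <= da + db by exact: addr_ge0.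
have zle : `|z| <= (`|p| + `|q|) * (da + db).
  rewrite /z (le_trans (ler_normD _ _))// !normrM (ger0_norm da0) (ger0_norm db0).
  by rewrite mulrDl lerD// ler_wpM2l// ?lerDl// lerDr.
have pq0 : 0 <= `|p| + `|q| by exact: addr_ge0.
have zhalf : `|z| <= 1 / 2.
  by apply: (le_trans zle); apply: le_trans small; rewrite ler_wpM2l.
have t1 : `|(expR z - 1 - z) * (1 + c * x u)| <=
    2 * (`|p| + `|q|) ^+ 2 * (1 + `|c| * (`|a| + `|b|)) * eta * (da + db).
  rewrite normrM.
  have h1 : `|expR z - 1 - z| <= 2 * (`|p| + `|q|) ^+ 2 * (eta * (da + db)).
    apply: (le_trans (expR_sub_linear_bound zhalf)).
    rewrite -mulrA ler_wpM2l//.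
    apply: (@le_trans _ _ (((`|p| + `|q|) * (da + db)) ^+ 2)).
      by rewrite -[z ^+ 2]real_normK ?num_real// ler_sqr ?nnegrE ?mulr_ge0.
    by rewrite exprMn ler_wpM2l ?sqr_ge0// expr2 ler_wpM2r.
  have h2 : `|1 + c * x u| <= 1 + `|c| * (`|a| + `|b|).
    rewrite (le_trans (ler_normD _ _))// normr1 lerD2l normrM ler_wpM2l//.
    exact: skorokhod_range_norm.
  apply: (le_trans (ler_pM _ _ h1 h2)) => //.
  by rewrite le_eqVlt; apply/orP; left; apply/eqP; ring.
have t2 : `|p * c * (da * (x u - a)) + q * c * (db * (x u - b))| <=
    (`|p| + `|q|) * `|c| * eta * (da + db).
  have ha := local_time_increment_bound (skorokhod_left sk) s0 su eta0 osc.
  have hb := local_time_increment_bound (skorokhod_right sk) s0 su eta0 osc.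
  rewrite (le_trans (ler_normD _ _))//.
  rewrite [`|p * c * _|]normrM [`|q * c * _|]normrM ![`|_ * c|]normrM.
  apply: (@le_trans _ _ (`|p| * `|c| * (eta * da) + `|q| * `|c| * (eta * db))).
    by apply: lerD; apply: ler_wpM2l => //; exact: mulr_ge0.
  rewrite -subr_ge0.
  have -> : (`|p| + `|q|) * `|c| * eta * (da + db) -
    (`|p| * `|c| * (eta * da) + `|q| * `|c| * (eta * db)) =
    `|p| * `|c| * eta * db + `|q| * `|c| * eta * da by ring.
  by rewrite addr_ge0// !mulr_ge0.
apply: (le_trans (ler_normD _ _)); apply: (le_trans (lerD t1 t2)).
by rewrite /K le_eqVlt; apply/orP; left; apply/eqP; ring.
Qed.

End reflected_path.

Section transform_limit.
Context {R : realType}.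
Variables (a b p q c t L rho : R) (x beta la lb : R -> R).
Hypothesis sk : skorokhod_path a b x beta la lb.
Hypothesis c_left : c = - (1 + c * a) * p.
Hypothesis c_right : c = (1 + c * b) * q.
Hypothesis cbeta : continuous_path beta.
Hypotheses (L0 : 0 < L) (rho0 : 0 <= rho) (rhoL : rho <= L).
Local Notation G := (boundary_time la lb).
Local Notation psi := (exp_local_time p q la lb).
Local Notation f := (harmonic_weight p q c x la lb).
Hypothesis G_before : forall s, 0 <= s -> s < rho -> G s <= t.
Hypothesis G_after : forall s, rho < s -> s <= L -> t < G s.

Lemma continuous_path_boundary_time : continuous_path G.
Proof.
apply: continuous_pathD; [exact: local_time_continuous (skorokhod_left sk)|].
exact: local_time_continuous (skorokhod_right sk).
Qed.

Lemma continuous_skorokhod_path : continuous_path x.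
Proof.
have cy : continuous_path (fun s => x 0 + beta s + la s + -1 * lb s).
  apply: continuous_pathD; last first.
    apply: continuous_pathM; first exact: continuous_path_cst.
    exact: local_time_continuous (skorokhod_right sk).
  apply: continuous_pathD; last exact: local_time_continuous (skorokhod_left sk).
  by apply: continuous_pathD => //; exact: continuous_path_cst.
apply: subspace_eq_continuous cy => s; rewrite inE /= in_itv /= andbT => s0.
apply: (etrans _ (esym (skorokhod_decomp sk s0))).
by rewrite /from_subspace; ring.
Qed.

Lemma continuous_path_exp_local_time : continuous_path psi.
Proof.
apply: continuous_path_expR; apply: continuous_pathD; apply: continuous_pathM;
  do ?exact: continuous_path_cst.
- exact: local_time_continuous (skorokhod_left sk).
- exact: local_time_continuous (skorokhod_right sk).
Qed.

Lemma continuous_path_harmonic_weight : continuous_path f.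
Proof.
apply: continuous_pathM; first exact: continuous_path_exp_local_time.
apply: continuous_pathD; first exact: continuous_path_cst.
apply: continuous_pathM; first exact: continuous_path_cst.
exact: continuous_skorokhod_path.
Qed.

Let cap := expR ((`|p| + `|q|) * t).

Lemma exp_local_time_cap s : 0 <= s -> G s <= t -> psi s <= cap.
Proof.
move=> s0 Gt; rewrite ler_expR.
have l0 := local_time_left_ge0 sk s0; have l1 := local_time_right_ge0 sk s0.
have h1 : la s <= t by apply: le_trans Gt; rewrite lerDl.
have h2 : lb s <= t by apply: le_trans Gt; rewrite lerDr.
rewrite mulrDl; apply: lerD; apply: (le_trans (ler_norm _)); rewrite normrM.
  by rewrite (ger0_norm l0) ler_wpM2l.
by rewrite (ger0_norm l1) ler_wpM2l.
Qed.

(** The minimum with [cap] is inactive while the clock is at most [t] on a reflected path, by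
    [exp_local_time_cap]; it bounds the coefficient on every sample point, exceptional ones
    included, as the moment estimates require. *)
Definition transform_coef (s : R) : R := c * Num.min (psi s) cap * alive G t s.

Let K : R := 2 * (`|p| + `|q|) ^+ 2 * (1 + `|c| * (`|a| + `|b|)) + (`|p| + `|q|) * `|c|.

(** The local errors are proportional to increments of the clock, which telescope to [G L]. This
    quantity depends on the path, so the estimate serves a pathwise limit only. *)
Lemma transform_error n eta : 0 <= eta -> (`|p| + `|q|) * eta <= 1 / 2 ->
  (forall s u, 0 <= s <= L -> 0 <= u <= L -> `|s - u| <= mesh L n ->
    [/\ `|x s - x u| <= eta, `|G s - G u| <= eta & `|beta s - beta u| <= 1]) ->
  `|\sum_(i < n.+1) transform_coef (grid L n i) *
       clip (beta (grid L n i.+1) - beta (grid L n i)) -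
    \sum_(i < n.+1) alive G t (grid L n i) * (f (grid L n i.+1) - f (grid L n i))|
  <= cap * (K * eta * G L).
Proof.
move=> eta0 small osc.
have K0 : 0 <= K by exact: transform_constant_ge0.
have g0 i : 0 <= grid L n i by exact: grid_ge0.
have gS i : grid L n i <= grid L n i.+1 by exact: le_grid.
have m0 : 0 < mesh L n by exact: mesh_gt0.
have -> : G L = \sum_(i < n.+1) (G (grid L n i.+1) - G (grid L n i)).
  rewrite -(big_mkord xpredT (fun i => G (grid L n i.+1) - G (grid L n i))).
  by rewrite telescope_sumr// grid_end// /grid mul0r (boundary_time0 sk) subr0.
rewrite -sumrB !mulr_sumr; apply: (le_trans (ler_norm_sum _ _ _)).
apply: ler_sum => -[i /= ni] _.
set s := grid L n i; set u := grid L n i.+1.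
have su : s <= u by exact: gS.
have s0 : 0 <= s by exact: g0.
have uL : u <= L by exact: grid_le.
have uE : u = s + mesh L n by exact: gridS.
have dG0 : 0 <= G u - G s by rewrite subr_ge0; exact: (boundary_time_mono sk).
have cap0 : 0 <= cap by exact: expR_ge0.
have rhs0 : 0 <= cap * (K * eta * (G u - G s)).
  by apply: mulr_ge0 => //; apply: mulr_ge0 => //; exact: mulr_ge0.
rewrite /transform_coef /alive; have [Gs|_] := lerP (G s) t; last first.
  by rewrite mulr0 !mul0r subrr normr0.
have pc := exp_local_time_cap s0 Gs.
rewrite (min_l pc) mulr1 mul1r.
have near v : s <= v <= u -> [/\ `|x v - x u| <= eta, `|G v - G u| <= eta
    & `|beta v - beta u| <= 1].
  move=> /andP[sv vu]; apply: osc.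
  - by rewrite (le_trans s0 sv) (le_trans vu uL).
  - by rewrite (le_trans s0 su).
  - by rewrite ler_distl (le_trans _ sv) ?(le_trans vu)// ?lerDl ?(ltW m0)// uE addrK.
have [_ Gsu bsu] := near s (introT andP (conj (lexx s) su)).
rewrite clip_id; last by rewrite distrC.
rewrite distrC -mulrA.
have st : `|f u - f s - c * psi s * (beta u - beta s)| <=
    psi s * (K * eta * (G u - G s)).
  apply: (harmonic_step sk c_left c_right s0 su eta0) => //.
    by move=> v /near[].
  by move: Gsu; rewrite distrC ger0_norm.
rewrite mulrA; apply: (le_trans st); rewrite ler_wpM2r//.
by apply: mulr_ge0 => //; exact: mulr_ge0.
Qed.

Lemma transform_cvg :
  \sum_(i < n.+1) transform_coef (grid L n i) *
       clip (beta (grid L n i.+1) - beta (grid L n i)) @[n --> \oo] -->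
  f rho - f 0.
Proof.
have sc := stopped_sum_cvg (boundary_time_mono sk) L0 rho0 rhoL G_before G_after
  continuous_path_harmonic_weight.
rewrite -[X in _ --> X]add0r.
rewrite (_ : (fun n => _) = (fun n => (\sum_(i < n.+1) transform_coef (grid L n i) *
       clip (beta (grid L n i.+1) - beta (grid L n i)) -
    \sum_(i < n.+1) alive G t (grid L n i) * (f (grid L n i.+1) - f (grid L n i))) +
    \sum_(i < n.+1) alive G t (grid L n i) * (f (grid L n i.+1) - f (grid L n i))));
  last by apply/funext => n; rewrite subrK.
apply: cvgD sc; apply/cvgr0Pnorm_le => eps eps0.
have K0 : 0 <= K by exact: transform_constant_ge0.
have GL0 : 0 <= G L.
  by rewrite -(boundary_time0 sk); apply: (boundary_time_mono sk) => //; exact: ltW.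
pose A := cap * (K * G L).
have A0 : 0 <= A by rewrite mulr_ge0 ?expR_ge0 ?mulr_ge0.
have pq0 : 0 <= `|p| + `|q| by exact: addr_ge0.
(* The first bound brings the total error [A * eta] below [eps], the second keeps the exponents
   within the range [1 / 2] of [expR_sub_linear_bound]. Adding 1 avoids vanishing denominators. *)
pose eta := Num.min (eps / (A + 1)) (1 / (2 * (`|p| + `|q| + 1))).
have eta0 : 0 < eta.
  by rewrite lt_min !divr_gt0 ?mulr_gt0 ?ltr_wpDl.
have small : (`|p| + `|q|) * eta <= 1 / 2.
  apply: (@le_trans _ _ ((`|p| + `|q|) * (1 / (2 * (`|p| + `|q| + 1))))).
    by rewrite ler_wpM2l// ge_min lexx orbT.
  rewrite mulrA mulr1 invfM mulrCA mul1r ler_piMr ?invr_ge0//.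
  by rewrite ler_pdivrMr ?mul1r ?lerDl// ltr_wpDl.
have etaA : cap * (K * eta * G L) <= eps.
  rewrite (_ : cap * (K * eta * G L) = A * eta); last by rewrite /A; ring.
  apply: (@le_trans _ _ (A * (eps / (A + 1)))).
    by rewrite ler_wpM2l// ge_min lexx.
  rewrite mulrCA ler_piMr ?(ltW eps0)// ler_pdivrMr ?mul1r ?lerDl// ltr_wpDl//.
have [r1 r10 h1] := uniform_continuous_path L continuous_skorokhod_path eta0.
have [r2 r20 h2] := uniform_continuous_path L continuous_path_boundary_time eta0.
have [r3 r30 h3] := uniform_continuous_path L cbeta (@ltr01 R).
near=> n.
have m1 : mesh L n < r1 by near: n; exact: near_mesh.
have m2 : mesh L n < r2 by near: n; exact: near_mesh.
have m3 : mesh L n < r3 by near: n; exact: near_mesh.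
apply: le_trans etaA; apply: transform_error => //; first exact: ltW.
move=> s u sL uL su; split.
- by apply: h1 => //; exact: le_lt_trans su m1.
- by apply: h2 => //; exact: le_lt_trans su m2.
- by apply: h3 => //; exact: le_lt_trans su m3.
Unshelve. all: by end_near. Qed.

End transform_limit.

(** * Reflected Brownian motion at the inverse local time *)

Section centered_limit.
Context {d} {T : measurableType d} {R : realType} (P : probability T R).

Lemma truncation_error (M v : R) : 0 < M ->
  `|v - Num.max (- M) (Num.min M v)| <= M^-1 * v ^+ 2.
Proof.
move=> M0; rewrite mulrC ler_pdivlMr//.
have MN : - M < 0 by rewrite oppr_lt0.
have [Mv|vM] := leP M v.
  rewrite max_r; last by apply: (le_trans (ltW MN)); exact: ltW.
  by rewrite ger0_norm ?subr_ge0//; nra.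
have [Mv|Mv] := lerP (- M) v.
  by rewrite subrr normr0 mul0r sqr_ge0.
by rewrite opprK ler0_norm; [nra|lra].
Qed.

(** Bounded second moments replace domination. Truncation at level [M] alters the mean of [u n] by
    at most [C / M], uniformly in [n], and leaves the limit unchanged when [K <= M]; bounded
    convergence applies to the truncated functions and then [M] is taken large. *)
Lemma centered_limit (u : nat -> T -> R) (l : {RV P >-> R}) (K C : R) :
  (forall n, bounded_measurable (u n)) ->
  (forall n, \int[P]_w u n w = 0) ->
  (forall n, \int[P]_w u n w ^+ 2 <= C) ->
  (forall w, `|l w| <= K) ->
  {ae P, forall w, u n w @[n --> \oo] --> l w} ->
  \int[P]_w l w = 0.
Proof.
move=> bu u0 u2 lK ul.
have C0 : 0 <= C by apply: le_trans (u2 0%N); apply: Rintegral_ge0 => w _; exact: sqr_ge0.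
have small (M : R) : 0 < M -> K <= M -> `|\int[P]_w l w| <= M^-1 * C.
  move=> M0 KM.
  pose tr (v : R) := Num.max (- M) (Num.min M v).
  have mtr : measurable_fun setT tr.
    by apply: measurable_maxr => //; exact: measurable_minr.
  have trM v : `|tr v| <= M.
    by rewrite /tr ler_norml le_max lexx /= ge_max ge_min lexx /= andbT; lra.
  have btr n : bounded_measurable (fun w => tr (u n w)).
    split; last by exists M.
    by apply: measurableT_comp => //; case: (bu n).
  have bu2 n : bounded_measurable (fun w => u n w ^+ 2).
    by under eq_fun do rewrite expr2; exact: bounded_measurableM.
  have ctr : (\int[P]_w tr (u n w)) @[n --> \oo] --> \int[P]_w l w.
    apply: (bounded_convergence (K := M)) => //.
    - by move=> n; case: (btr n).
    - apply: filterS ul => w ulw.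
      have trl : tr (l w) = l w.
        have := lK w; rewrite ler_norml => /andP[l1 l2].
        have {}l2 : l w <= M by exact: le_trans KM.
        have {}l1 : - M <= l w by apply: le_trans l1; rewrite lerN2.
        by rewrite /tr min_r// max_r.
      rewrite -trl.
      have ctr : continuous tr.
        move=> v; apply: (@continuous_max _ R (fun=> - M) (fun v => Num.min M v)).
          exact: cvg_cst.
        by apply: (@continuous_min _ R (fun=> M) id); [exact: cvg_cst|exact: cvg_id].
      exact: (cvg_comp (u^~ w) tr ulw (ctr (l w))).
  have le n : `|\int[P]_w tr (u n w)| <= M^-1 * C.
    have -> : \int[P]_w tr (u n w) = - \int[P]_w (u n w - tr (u n w)).
      rewrite RintegralB//; do ?exact: bounded_measurable_integrable.
      by rewrite u0 sub0r opprK.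
    rewrite normrN.
    apply: (@le_trans _ _ (\int[P]_w (M^-1 * u n w ^+ 2))).
      apply: le_norm_Rintegral.
      - exact: bounded_measurableB.
      - by apply: bounded_measurableM => //; exact: bounded_measurable_cst.
      - by move=> w; exact: truncation_error.
    rewrite RintegralZl//; last exact: bounded_measurable_integrable.
    by rewrite ler_wpM2l// invr_ge0 ltW.
  by apply: (cvgr_to_le (cvg_norm ctr)); exact: nearW.
apply/eqP; rewrite -normr_le0 leNgt; apply/negP => h.
pose e := `|\int[P]_w l w|.
(* At this level [C / M] is strictly below [e], the supposed positive absolute value of the mean. *)
pose M := Num.max (Num.max 1 K) ((C + 1) / e).
have M0 : 0 < M by rewrite !lt_max ltr01.
have KM : K <= M by rewrite !le_max lexx orbT.
have := small M M0 KM; apply/negP; rewrite -ltNge.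
rewrite mulrC ltr_pdivrMr// -/e.
apply: (@lt_le_trans _ _ (e * ((C + 1) / e))).
  by rewrite mulrCA divff ?gt_eqF// mulr1 ltrDl.
by rewrite ler_pM2l// le_max lexx orbT.
Qed.

Lemma ae_version_bound (x : T -> R) (X : {RV P >-> R}) (K : R) : 0 <= K ->
  {ae P, forall w, x w = X w} -> {ae P, forall w, `|x w| <= K} ->
  exists Y : {RV P >-> R}, (forall w, `|Y w| <= K) /\ {ae P, forall w, x w = Y w}.
Proof.
move=> K0 xX xK.
pose Y w := Num.max (- K) (Num.min K (X w)).
have mY : measurable_fun setT Y.
  by apply: measurable_maxr => //; exact: measurable_minr.
exists (mfun_of mY); split => [w|] /=.
  by rewrite /Y ler_norml le_max lexx /= ge_max ge_min lexx /= andbT; lra.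
apply: filterS2 xX xK => w xX; rewrite ler_norml => /andP[x1 x2].
by rewrite /= /Y -xX min_r// max_r.
Qed.

End centered_limit.

(** * The inverse of a continuous clock, cut at a finite horizon *)

Section inverse_time.
Context {R : realType}.
Variables (G : R -> R) (t : R).
Hypotheses (G_mono : forall s u, 0 <= s -> s <= u -> G s <= G u).
Hypotheses (cG : continuous_path G) (G0 : G 0 <= t).

(** The passage time cut at [L]. A plain minimum of [inverse_time G t] and [L] would be wrong: if
    the clock never passes [t], the infimum of the empty set is 0 instead of infinity. *)
Definition stopped_inverse_time (L : R) : R :=
  if t < G L then inverse_time G t else L.

Let passed := [set s | 0 <= s /\ t < G s].

Let passed_lb : has_lbound passed. Proof. by exists 0 => s []. Qed.

Lemma inverse_time_ge0 : 0 <= inverse_time G t.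
Proof.
rewrite /inverse_time -/passed.
have [->|/set0P ne] := eqVneq passed set0; first by rewrite inf0.
by apply: lb_le_inf => // s [].
Qed.

Section horizon.
Variable L : R.
Hypothesis L0 : 0 <= L.
Local Notation rho := (stopped_inverse_time L).

Lemma stopped_inverse_time_ge0 : 0 <= rho.
Proof. by rewrite /stopped_inverse_time; case: ifP => // _; exact: inverse_time_ge0. Qed.

Lemma stopped_inverse_time_le : rho <= L.
Proof.
rewrite /stopped_inverse_time; case: ifP => // tL.
by apply: ge_inf => //; split.
Qed.

Lemma stopped_inverse_time_before s : 0 <= s -> s < rho -> G s <= t.
Proof.
move=> s0; rewrite /stopped_inverse_time; case: ifPn => [tL|]; last first.
  by rewrite -leNgt => Lt sL; apply: le_trans Lt; apply: G_mono => //; exact: ltW.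
move=> sr; rewrite leNgt; apply/negP => ts.
have : inverse_time G t <= s by apply: ge_inf => //; split.
by rewrite leNgt sr.
Qed.

Lemma stopped_inverse_time_after s : rho < s -> s <= L -> t < G s.
Proof.
rewrite /stopped_inverse_time; case: ifPn => [tL|_]; last first.
  by move=> Ls sL; have := lt_le_trans Ls sL; rewrite ltxx.
move=> rs sL.
have ne : passed !=set0 by exists L; split.
have [u [u0 tu] us] := inf_lt ne rs.
by apply: (lt_le_trans tu); apply: G_mono => //; exact: ltW.
Qed.

(** The clock is at most [t] at all earlier times, and continuity from the left carries this to
    [rho]; the start is covered by [G0]. *)
Lemma boundary_time_stopped : G rho <= t.
Proof.
have [r0|r0] := eqVneq rho 0; first by rewrite r0.
have {}r0 : 0 < rho by rewrite lt_neqAle eq_sym r0 stopped_inverse_time_ge0.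
rewrite leNgt; apply/negP => tr.
have e0 : 0 < (G rho - t) / 2 by rewrite divr_gt0// subr_gt0.
have [r rr hr] := continuous_pathP cG (ltW r0) e0.
pose s := Num.max 0 (rho - r / 2).
have s0 : 0 <= s by rewrite le_max lexx.
have sr : s < rho by rewrite gt_max r0 ltrBlDr ltrDl divr_gt0.
have Gs := stopped_inverse_time_before s0 sr.
have : `|G rho - G s| <= (G rho - t) / 2.
  apply: hr => //; rewrite gtr0_norm ?subr_gt0//.
  apply: (@le_lt_trans _ _ (r / 2)); last by rewrite ltr_pdivrMr// ltr_pMr// ltr1n.
  by rewrite lerBlDr -lerBlDl le_max lexx orbT.
apply/negP; rewrite -ltNge; apply: (@lt_le_trans _ _ (G rho - G s)); last exact: ler_norm.
apply: (@lt_le_trans _ _ (G rho - t)); last by rewrite lerD2l lerN2.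
by rewrite ltr_pdivrMr// ltr_pMr ?subr_gt0// ltr1n.
Qed.

End horizon.

Lemma stopped_inverse_timeE L : t < G L -> stopped_inverse_time L = inverse_time G t.
Proof. by rewrite /stopped_inverse_time => ->. Qed.

(** Continuity from the right gives the missing inequality: the clock exceeds [t] immediately after
    the passage time, which lies strictly before [L]. *)
Lemma boundary_time_inverse L : 0 <= L -> t < G L -> G (inverse_time G t) = t.
Proof.
move=> L0 tL; rewrite -(stopped_inverse_timeE tL).
apply/eqP; rewrite eq_le boundary_time_stopped//=.
set r := stopped_inverse_time L; have r0 : 0 <= r by exact: stopped_inverse_time_ge0.
rewrite leNgt; apply/negP => rt.
have e0 : 0 < (t - G r) / 2 by rewrite divr_gt0// subr_gt0.
have [z zz hz] := continuous_pathP cG r0 e0.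
have rL : r < L.
  rewrite lt_neqAle stopped_inverse_time_le// andbT; apply/eqP => rL.
  by move: rt; rewrite rL ltNge (ltW tL).
pose s := Num.min L (r + z / 2).
have rs : r < s by rewrite lt_min rL ltrDl divr_gt0.
have sL : s <= L by rewrite ge_min lexx.
have s0 : 0 <= s by exact: le_trans r0 (ltW rs).
have ts : t < G s by apply: (stopped_inverse_time_after L0 rs sL).
have : `|G r - G s| <= (t - G r) / 2.
  apply: hz => //; rewrite ltr0_norm ?subr_lt0// opprB.
  apply: (@le_lt_trans _ _ (z / 2)); last by rewrite ltr_pdivrMr// ltr_pMr// ltr1n.
  by rewrite lerBlDl ge_min lexx orbT.
apply/negP; rewrite -ltNge; apply: (@lt_le_trans _ _ (G s - G r)); last first.
  by rewrite distrC; exact: ler_norm.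
apply: (@le_lt_trans _ _ (t - G r)); last by rewrite ltrD2r.
by rewrite ler_pdivrMr// ler_pMr ?subr_gt0// ler1n.
Qed.

End inverse_time.

Section reflected_identity.
Context {d} {T : measurableType d} {R : realType} (P : probability T R).
Variables (F : R -> set (set T)) (beta t : R) (X B ga gb : R -> T -> R).
Hypotheses (beta0 : 0 < beta) (t0 : 0 <= t).
Hypothesis rbm : is_reflected_brownian P F (- beta) beta X B ga gb.
Hypothesis X0_left : P [set w | X 0 w = - beta] = (1 / 2)%:E.
Hypothesis X0_right : P [set w | X 0 w = beta] = (1 / 2)%:E.

Let filF := reflected_filtration rbm.
Let brB := reflected_brownian rbm.

Local Notation past s := (g_sigma_algebraType (F s)).
Local Notation G w := (boundary_time (ga^~ w) (gb^~ w)).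
Local Notation r w := (inverse_time (G w) t).
Local Notation rho L w := (stopped_inverse_time (G w) t L).

Definition good_path (w : T) : Prop :=
  skorokhod_path (- beta) beta (X^~ w) (B^~ w) (ga^~ w) (gb^~ w) /\
  continuous_path (B^~ w).

Lemma ae_good_path : {ae P, forall w, good_path w}.
Proof.
apply: filterS2 (reflected_skorokhod rbm) (brownian_continuous brB) => w h1 h2.
by split.
Qed.

Lemma adapted_measurable (Y : R -> T -> R) s : adapted F Y -> 0 <= s ->
  measurable_fun setT (Y s).
Proof.
move=> adY s0; apply: (measurable_past filF s0).
exact: adapted_measurable_fun.
Qed.

Lemma adapted_boundary_time : adapted F (fun s w => G w s).
Proof.
move=> s s0 A mA.
have m : measurable_fun setT (fun w : past s => G w s).
  apply: measurable_funD; apply: (adapted_measurable_fun filF) => //.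
    exact: reflected_adapted_left rbm.
  exact: reflected_adapted_right rbm.
have := m measurableT A mA; rewrite setTI => h.
by rewrite -(sigma_algebra_id (filtration_sigma filF s0)).
Qed.

Let G_mono w : good_path w -> forall s u, 0 <= s -> s <= u -> G w s <= G w u.
Proof. by move=> [sk _] s u s0 su; exact: (boundary_time_mono sk s0 su). Qed.

Let G_cont w : good_path w -> continuous_path (G w).
Proof. by move=> [sk _]; exact: continuous_path_boundary_time sk. Qed.

Let G_start w : good_path w -> G w 0 <= t.
Proof. by move=> [sk _]; rewrite (boundary_time0 sk). Qed.

(* While the boundary clock is below [t], the driving Brownian motion stays in
   a fixed interval, and this becomes unlikely as time goes on. *)
Lemma increment_confined w s : good_path w -> 0 <= s -> G w s <= t ->
  `|B s w - B 0 w| <= 2 * beta + t.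
Proof.
move=> [sk _] s0 Gt.
have /andP[x1 x2] := skorokhod_range sk s0.
have /andP[x3 x4] := skorokhod_range sk (lexx 0).
have d1 := skorokhod_decomp sk s0; have d0 := skorokhod_decomp sk (lexx 0).
have l0 := local_time_left_ge0 sk s0; have l1 := local_time_right_ge0 sk s0.
have z0 := local_time_start (skorokhod_left sk).
have z1 := local_time_start (skorokhod_right sk).
have Gt' : ga s w + gb s w <= t := Gt.
by rewrite ler_norml; apply/andP; split; lra.
Qed.

Lemma ae_boundary_time_unbounded :
  {ae P, forall w, exists n : nat, t < G w n%:R}.
Proof.
have [N [mN N0 subN]] := ae_good_path.
pose A := \bigcap_n [set w | G w n%:R <= t].
have mG n : measurable [set w | G w n%:R <= t].
  have m : measurable_fun setT (fun w => G w n%:R).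
    exact: (adapted_measurable adapted_boundary_time).
  have := m measurableT _ (measurable_itv `]-oo, t]); rewrite setTI.
  by congr measurable; apply/seteqP; split => w /=; rewrite in_itv.
have mA : measurable A by exact: bigcap_measurable.
exists A; split => //; last first.
  move=> w /= h n _ /=; rewrite leNgt; apply/negP => tn.
  by apply: h; exists n.
pose C := 2 * beta + t.
have C0 : 0 <= C by rewrite addr_ge0// mulr_ge0// ltW.
pose sd n : R := Num.sqrt (2 * (n.+1%:R - 0)).
have sd0 n : 0 < sd n by rewrite sqrtr_gt0 subr0 mulr_gt0.
(* If the clock never passes [t], the increment of [B] up to time [n.+1] lies in [[- C, C]]; since
   its standard deviation [sd n] tends to infinity, this probability tends to 0. *)
have bound n : (P A <= (2 * C / sd n)%:E)%E.
  pose E := (B n.+1%:R \- B 0) @^-1` `[- C, C]%classic.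
  have mE : measurable E.
    have m : measurable_fun setT (B n.+1%:R \- B 0).
      by apply: measurable_funB; apply: adapted_measurable => //; exact: brownian_adapted brB.
    by have := m measurableT _ (measurable_itv `[- C, C]); rewrite setTI.
  apply: (@le_trans _ _ (P (E `|` N))).
    apply: le_measure; rewrite ?inE//; first exact: measurableU.
    move=> w wA; have [gw|ngw] := pselect (good_path w); last by right; exact: subN.
    left; rewrite /E /= in_itv /= -ler_norml.
    by apply: increment_confined => //; exact: wA.
  apply: (le_trans (measureU2 _ mE mN)).
  rewrite [X in (_ + X)%E]N0 adde0; apply: le_trans (normal_prob_itv_le (sd0 n) C0).
  have lt0n : (0 : R) < n.+1%:R by rewrite ltr0Sn.
  have EE := brownian_increment brB (lexx 0) lt0n (measurable_itv `[- C, C]).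
  by rewrite le_eqVlt; apply/orP; left; apply/eqP; exact: EE.
have cv : (2 * C / sd n)%:E @[n --> \oo] --> (0%R)%:E.
  apply: cvg_EFin; first exact: nearW.
  apply/cvgr0Pnorm_le => eps eps0; near=> n.
  rewrite /= ger0_norm ?divr_ge0 ?mulr_ge0 ?(ltW (sd0 n))//.
  rewrite ler_pdivrMr// [leRHS]mulrC -ler_pdivrMr//.
  have K0 : 0 <= 2 * C / eps by rewrite divr_ge0 ?mulr_ge0// ltW.
  rewrite -[leLHS](ger0_norm K0) -sqrtr_sqr.
  apply: ler_wsqrtr; rewrite subr0.
  apply: (@le_trans _ _ n%:R); first by near: n; exact: nbhs_infty_ger.
  by rewrite -natrM ler_nat mul2n -addnn -addSnnS leq_addl.
apply/eqP; rewrite -measure_le0; apply: (cvge_to_ge cv); exact: nearW.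
Unshelve. all: by end_near. Qed.

Lemma adapted_measurable_past (Y : R -> T -> R) :
  (forall s, 0 <= s -> measurable_fun setT (Y s : past s -> R)) -> adapted F Y.
Proof.
move=> mY s s0 A mA; have := mY s s0 measurableT A mA; rewrite setTI => h.
by rewrite -(sigma_algebra_id (filtration_sigma filF s0)).
Qed.

Lemma bounded_measurable_alive (s u : R) : 0 <= s -> s <= u ->
  bounded_measurable (fun w : past u => alive (G w) t s).
Proof.
move=> s0 su; split; last by exists 1 => w; rewrite /alive normr_nat lern1 leq_b1.
rewrite (_ : (fun w => _) = (fun w : past u => if G w s <= t then 1 else 0)); last first.
  by apply/funext => w; rewrite /alive; case: ifP.
apply: measurable_fun_ifT => //; apply: measurable_fun_ler => //.
exact: (adapted_measurable_fun filF adapted_boundary_time).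
Qed.

Lemma stopped_time_spec w L : good_path w -> 0 <= L ->
  [/\ 0 <= rho L w, rho L w <= L,
    (forall s, 0 <= s -> s < rho L w -> G w s <= t),
    (forall s, rho L w < s -> s <= L -> t < G w s) & G w (rho L w) <= t].
Proof.
move=> gw L0; split.
- exact: stopped_inverse_time_ge0.
- exact: stopped_inverse_time_le.
- exact: (stopped_inverse_time_before (G_mono gw)).
- exact: (stopped_inverse_time_after (G_mono gw)).
- exact: (boundary_time_stopped (G_mono gw) (G_cont gw) (G_start gw)).
Qed.

Lemma near_inverse_time w : good_path w -> (exists n : nat, t < G w n%:R) ->
  \forall n \near \oo, rho n.+1%:R w = r w.
Proof.
move=> gw [m tm]; near=> n; apply: stopped_inverse_timeE.
apply: (lt_le_trans tm); apply: (G_mono gw) => //.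
rewrite ler_nat; apply: leqW; near: n; exact: nbhs_infty_ge.
Unshelve. all: by end_near. Qed.

Lemma good_inverse_time w : good_path w -> (exists n : nat, t < G w n%:R) ->
  0 <= r w /\ G w (r w) = t.
Proof.
move=> gw [m tm]; split; first exact: inverse_time_ge0.
exact: (boundary_time_inverse (G_mono gw) (G_cont gw) (G_start gw) (ler0n R m) tm).
Qed.

Section versions.
Variable Y : R -> T -> R.
Hypothesis adY : adapted F Y.
Hypothesis cY : {ae P, forall w, continuous_path (Y^~ w)}.

(** The value at the random time is a pathwise limit of stopped telescoping sums of adapted
    variables. This gives a random variable without discussing the measurability of the time itself
    or the joint measurability of [Y]. *)
Lemma stopped_version L : 0 < L ->
  exists V : {RV P >-> R}, {ae P, forall w, Y (rho L w) w = V w}.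
Proof.
move=> L0.
pose u n w := Y 0 w + \sum_(i < n.+1) alive (G w) t (grid L n i) *
  (Y (grid L n i.+1) w - Y (grid L n i) w).
have g0 n i : 0 <= grid L n i by exact: grid_ge0.
apply: (@ae_limit_version _ _ _ P u).
  move=> n; apply: measurable_funD; first exact: adapted_measurable.
  apply: measurable_sum => i; apply: measurable_funM; last first.
    by apply: measurable_funB; exact: adapted_measurable.
  apply: (measurable_past filF (g0 n i)).
  by case: (bounded_measurable_alive (g0 n i) (lexx _)).
apply: filterS2 ae_good_path cY => w gw cw.
have [h1 h2 h3 h4 _] := stopped_time_spec gw (ltW L0).
have := stopped_sum_cvg (G_mono gw) L0 h1 h2 h3 h4 cw.
move=> h; rewrite [X in _ --> X](_ : _ = Y 0 w + (Y (rho L w) w - Y 0 w)); last by ring.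
by apply: cvgD; [exact: cvg_cst|exact: h].
Qed.

Lemma inverse_time_version :
  exists V : {RV P >-> R}, {ae P, forall w, Y (r w) w = V w}.
Proof.
have /choice[V VE] (n : nat) : exists V : {RV P >-> R},
    {ae P, forall w, Y (rho n.+1%:R w) w = V w}.
  by apply: stopped_version; rewrite ltr0Sn.
apply: (@ae_limit_version _ _ _ P (fun n => V n)) => //.
have /ae_foralln aV := VE.
apply: filterS3 ae_good_path ae_boundary_time_unbounded aV => w gw uw Vw.
apply: cvg_near_cst; apply: filterS (near_inverse_time gw uw) => n rn.
by rewrite -Vw rn.
Qed.

End versions.

Section martingale.
Variables (mu y : R).
Hypotheses (mu0 : 0 < mu) (y_root : mu * y ^+ 2 - beta^-1 * y - mu = 0).

(** With these coefficients [p * la + q * lb] is [mu * (la - lb) + mu * y * (la + lb)], the exponent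
    of the identity, and both boundary conditions reduce to [y_root] in the form
    [y / beta = mu * y ^+ 2 - mu]. *)
Let c := y / beta.
Let p := mu * y + mu.
Let q := mu * y - mu.

Let y_eq : y / beta = mu * y ^+ 2 - mu.
Proof.
rewrite mulrC; apply/eqP; rewrite -subr_eq0; apply/eqP; rewrite -[RHS]oppr0 -y_root.
by ring.
Qed.

Lemma reflected_coef_left : c = - (1 + c * - beta) * p.
Proof.
rewrite {2}/c mulrN divfK ?gt_eqF// /c y_eq /p; ring.
Qed.

Lemma reflected_coef_right : c = (1 + c * beta) * q.
Proof. by rewrite {2}/c divfK ?gt_eqF// /c y_eq /q; ring. Qed.

Local Notation f w := (harmonic_weight p q c (X^~ w) (ga^~ w) (gb^~ w)).
Let cap := expR ((`|p| + `|q|) * t).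
Let coef (s : R) (w : T) := transform_coef p q c t (ga^~ w) (gb^~ w) s.

Let coef_bound s w : `|coef s w| <= `|c| * cap.
Proof.
rewrite /coef /transform_coef !normrM -[leRHS]mulr1; apply: ler_pM => //.
  rewrite ler_wpM2l// ger0_norm ?ge_min ?lexx ?orbT//.
  by rewrite le_min !expR_ge0.
by rewrite /alive normr_nat lern1 leq_b1.
Qed.

Let coef_measurable s : 0 <= s -> measurable_fun setT (coef s : past s -> R).
Proof.
move=> s0; apply: measurable_funM; last by case: (bounded_measurable_alive s0 (lexx s)).
apply: measurable_funM => //; apply: measurable_minr => //.
apply: measurableT_comp => //; apply: measurable_funD; apply: measurable_funM => //;
  apply: (adapted_measurable_fun filF) => //.
- exact: reflected_adapted_left rbm.
- exact: reflected_adapted_right rbm.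
Qed.

Let Kf : R := cap * (1 + `|c| * (`|- beta| + `|beta|)) + (1 + `|c| * (`|- beta| + `|beta|)).

Lemma harmonic_weight_bound w L : good_path w -> 0 <= L ->
  `|f w (rho L w) - f w 0| <= Kf.
Proof.
move=> gw L0; have [h1 h2 h3 h4 h5] := stopped_time_spec gw L0; have [sk _] := gw.
have lin s : 0 <= s -> `|1 + c * X s w| <= 1 + `|c| * (`|- beta| + `|beta|).
  move=> s0; rewrite (le_trans (ler_normD _ _))// normr1 lerD2l normrM ler_wpM2l//.
  exact: (skorokhod_range_norm sk s0).
apply: (le_trans (ler_normB _ _)); apply: lerD.
  rewrite /harmonic_weight normrM; apply: ler_pM => //; last exact: lin.
  rewrite ger0_norm ?expR_ge0//; exact: (exp_local_time_cap p q sk h1 h5).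
by rewrite (harmonic_weight0 p q c sk); exact: lin.
Qed.

(** The clipped transforms are centred and converge almost surely to the increment of the weight.
    The number of steps times the mesh is [L], so their second moments are bounded independently of
    [n] and the limit is centred too. *)
Lemma stopped_harmonic_mean (L : R) : 0 < L ->
  exists Z : {RV P >-> R}, [/\ (forall w, `|Z w| <= Kf),
    {ae P, forall w, f w (rho L w) - f w 0 = Z w} & \int[P]_w Z w = 0].
Proof.
move=> L0.
pose u n := clipped_transform B (mesh L n) (fun i => coef (grid L n i)) n.+1.
have uP n := clipped_transformP filF brB (mesh_gt0 L0 n)
  (fun i w => coef_bound (grid L n i) w)
  (fun i => coef_measurable (grid_ge0 L0 n i)) n.+1.
have bu n : bounded_measurable (u n).
  by have [b _ _] := uP n; apply: (bounded_measurable_past filF _ b); exact: (grid_ge0 L0 n n.+1).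
have ul : {ae P, forall w, u n w @[n --> \oo] --> f w (rho L w) - f w 0}.
  apply: filterS ae_good_path => w gw; have [sk cB] := gw.
  have [h1 h2 h3 h4 h5] := stopped_time_spec gw (ltW L0).
  exact: (transform_cvg sk reflected_coef_left reflected_coef_right cB L0 h1 h2 h3 h4).
have [Z0 Z0E] := ae_limit_version (fun n => (bu n).1) ul.
have Kf0 : 0 <= Kf by rewrite addr_ge0 ?mulr_ge0 ?expR_ge0 ?addr_ge0 ?mulr_ge0 ?addr_ge0.
have [Z [ZK ZE]] := ae_version_bound Kf0 Z0E
  (filterS (fun w gw => harmonic_weight_bound gw (ltW L0)) ae_good_path).
exists Z; split => //.
apply: (@centered_limit _ _ _ P u Z Kf (L * (16 * (`|c| * cap) ^+ 2))) => //.
- by move=> n; have [_ m _] := uP n.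
- move=> n; have [_ _ m] := uP n; apply: (le_trans m).
  rewrite le_eqVlt; apply/orP; left; apply/eqP.
  have e : n.+1%:R * mesh L n = L := grid_end L n.
  by rewrite -[in RHS]e; ring.
- by apply: filterS2 ul ZE => w h <-.
Qed.

Let X0 (w : T) : R := beta - 2 * beta * \1_[set w | X 0 w = - beta] w.

Let mX0 (z : R) : measurable [set w | X 0 w = z].
Proof.
have m := adapted_measurable (reflected_adapted rbm) (lexx 0).
by have := m measurableT _ (measurable_set1 z); rewrite setTI.
Qed.

Let X0E : {ae P, forall w, X 0 w = X0 w}.
Proof.
have : P ([set w | X 0 w = - beta] `|` [set w | X 0 w = beta]) = 1%E.
  rewrite measureU//.
    transitivity ((1 / 2)%:E + (1 / 2)%:E : \bar R)%E; last by rewrite -EFinD; congr EFin; lra.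
    by congr (_ + _)%E; [exact: X0_left|exact: X0_right].
  apply/seteqP; split => // w /= [-> h]; exfalso; move: h beta0; lra.
move=> /probability1_ae h; have {}h := h (measurableU _ _ (mX0 _) (mX0 _)).
apply: filterS h => w; rewrite /X0 indicE => -[]/= xw.
  by rewrite mem_set// xw mulr1; ring.
rewrite memNset; first by rewrite xw mulr0 subr0.
by move=> /=; rewrite xw => h; move: h beta0; lra.
Qed.

Let bX0 : bounded_measurable X0.
Proof.
apply: bounded_measurableB; first exact: bounded_measurable_cst.
apply: bounded_measurableM; first exact: bounded_measurable_cst.
exact: bounded_measurable_indic.
Qed.

(** The uniform start on the two end points makes the initial position centred, so the initial
    weight has mean 1. *)
Lemma start_mean : \int[P]_w (1 + c * X0 w) = 1.
Proof.
have b1 : bounded_measurable (\1_[set w | X 0 w = - beta] : T -> R).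
  exact: bounded_measurable_indic.
rewrite (_ : (fun w => _) = (fun w => (1 + c * beta) -
    (c * (2 * beta)) * \1_[set w | X 0 w = - beta] w)); last first.
  by apply/funext => w; rewrite /X0; ring.
rewrite RintegralB//; last 2 first.
- by apply: bounded_measurable_integrable; exact: bounded_measurable_cst.
- apply: bounded_measurable_integrable.
  by apply: bounded_measurableM => //; exact: bounded_measurable_cst.
rewrite Rintegral_prob_cst RintegralZl//; last exact: bounded_measurable_integrable.
have -> : \int[P]_w \1_[set w | X 0 w = - beta] w = 1 / 2.
  rewrite /Rintegral integral_indic// setIT.
  exact: (congr1 fine X0_left).
by field.
Qed.

(** As the horizon grows, the stopped time is eventually the inverse time on almost every path,
    while the weights stay below [Kf]. At the inverse time the clock equals [t], which turns the
    exponent into [mu * D + mu * y * t], and [c * X] is [- y * Xi]. *)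
Lemma reflected_mean (D Xi : {RV P >-> R}) :
  {ae P, forall w, ga (r w) w - gb (r w) w = D w} ->
  {ae P, forall w, - beta^-1 * X (r w) w = Xi w} ->
  (forall w, `|D w| <= t) -> (forall w, `|Xi w| <= 1) ->
  \int[P]_w (expR (mu * D w + mu * y * t) * (1 - y * Xi w)) = 1.
Proof.
move=> DE XiE Dt Xi1.
have /choice[Z ZP] (n : nat) : exists Z : {RV P >-> R},
   [/\ (forall w, `|Z w| <= Kf),
    {ae P, forall w, f w (rho n.+1%:R w) - f w 0 = Z w} & \int[P]_w Z w = 0].
  by apply: stopped_harmonic_mean; rewrite ltr0Sn.
have bE : bounded_measurable (fun w => expR (mu * D w + mu * y * t)).
  split.
    apply: measurableT_comp => //; apply: measurable_funD => //.
    exact: measurable_funM.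
  exists (expR (mu * t + mu * y * t)) => w; rewrite ger0_norm ?expR_ge0// ler_expR.
  by rewrite lerD2r ler_wpM2l ?(ltW mu0)//; exact: le_trans (ler_norm _) (Dt w).
have bL : bounded_measurable (fun w => 1 - y * Xi w).
  apply: bounded_measurableB; first exact: bounded_measurable_cst.
  apply: bounded_measurableM; first exact: bounded_measurable_cst.
  by split => //; exists 1.
have bW : bounded_measurable (fun w => expR (mu * D w + mu * y * t) * (1 - y * Xi w)).
  exact: bounded_measurableM.
have bS : bounded_measurable (fun w => 1 + c * X0 w).
  apply: bounded_measurableD; first exact: bounded_measurable_cst.
  by apply: bounded_measurableM => //; exact: bounded_measurable_cst.
suff : \int[P]_w (expR (mu * D w + mu * y * t) * (1 - y * Xi w) - (1 + c * X0 w)) = 0.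
  rewrite RintegralB//; do ?exact: bounded_measurable_integrable.
  by rewrite start_mean => /eqP; rewrite subr_eq0 => /eqP.
have cv : (\int[P]_w Z n w) @[n --> \oo] -->
    \int[P]_w (expR (mu * D w + mu * y * t) * (1 - y * Xi w) - (1 + c * X0 w)).
  apply: (bounded_convergence (K := Kf)) => //.
  - by case: (bounded_measurableB bW bS).
  - by move=> n w; have [] := ZP n.
  - have /ae_foralln aZ : forall n, {ae P, forall w, f w (rho n.+1%:R w) - f w 0 = Z n w}.
      by move=> n; have [] := ZP n.
    have aDX : {ae P, forall w, ga (r w) w - gb (r w) w = D w /\
        - beta^-1 * X (r w) w = Xi w /\ X 0 w = X0 w}.
      by apply: filterS3 DE XiE X0E => w; split.
    have agu : {ae P, forall w, good_path w /\ exists n : nat, t < G w n%:R}.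
      by apply: filterS2 ae_good_path ae_boundary_time_unbounded => w; split.
    apply: filterS3 agu aZ aDX => w [gw uw] Zw [Dw [Xw X0w]].
    apply: cvg_near_cst; apply: filterS (near_inverse_time gw uw) => n rn.
    rewrite -Zw rn; have [sk _] := gw; have [r0 Gr] := good_inverse_time gw uw.
    rewrite (harmonic_weight0 p q c sk) -X0w /harmonic_weight /exp_local_time.
    congr (expR _ * _ - _).
      rewrite -Dw.
      have -> : mu * y * t = mu * y * (ga (r w) w + gb (r w) w).
        by congr (_ * _); exact/esym.
      by rewrite /p /q; ring.
    by rewrite -Xw /c; ring.
apply: (cvg_unique _ cv) => //; apply: cvg_near_cst; apply: nearW => n.
by have [] := ZP n.
Qed.

End martingale.

Lemma reflected_identity : exists D Xi : {RV P >-> R},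
  [/\ {ae P, forall w, ga (r w) w - gb (r w) w = D w},
      (forall w, `|D w| <= t), (forall w, `|Xi w| <= 1) &
      forall mu y, 0 < mu -> mu * y ^+ 2 - beta^-1 * y - mu = 0 ->
        \int[P]_w (expR (mu * D w + mu * y * t) * (1 - y * Xi w)) = 1].
Proof.
have agu : {ae P, forall w, good_path w /\ exists n : nat, t < G w n%:R}.
  by apply: filterS2 ae_good_path ae_boundary_time_unbounded => w; split.
have [D0 D0E] : exists V : {RV P >-> R},
    {ae P, forall w, ga (r w) w - gb (r w) w = V w}.
  apply: (inverse_time_version (Y := fun s w => ga s w - gb s w)).
    apply: adapted_measurable_past => s s0; apply: measurable_funB;
      apply: (adapted_measurable_fun filF) => //.
      exact: reflected_adapted_left rbm.
    exact: reflected_adapted_right rbm.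
  apply: filterS ae_good_path => w [sk _].
  under [X in continuous_path X]eq_fun do rewrite -mulN1r.
  apply: continuous_pathD; first exact: local_time_continuous (skorokhod_left sk).
  apply: continuous_pathM; first exact: continuous_path_cst.
  exact: local_time_continuous (skorokhod_right sk).
have [X0 X0E] : exists V : {RV P >-> R},
    {ae P, forall w, - beta^-1 * X (r w) w = V w}.
  apply: (inverse_time_version (Y := fun s w => - beta^-1 * X s w)).
    apply: adapted_measurable_past => s s0; apply: measurable_funM => //.
    by apply: (adapted_measurable_fun filF) => //; exact: reflected_adapted rbm.
  apply: filterS ae_good_path => w [sk cB].
  apply: continuous_pathM; first exact: continuous_path_cst.
  exact: continuous_skorokhod_path sk cB.
have [|D [Dt DE]] := ae_version_bound t0 D0E.
  apply: filterS agu => w [gw uw]; have [sk _] := gw.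
  have [r0 Gr] := good_inverse_time gw uw.
  have l0 := local_time_left_ge0 sk r0; have l1 := local_time_right_ge0 sk r0.
  have Gr' : ga (r w) w + gb (r w) w = t := Gr.
  by rewrite ler_norml; apply/andP; split; lra.
have [|Xi [Xi1 XiE]] := ae_version_bound ler01 X0E.
  apply: filterS agu => w [gw uw]; have [sk _] := gw.
  have [r0 _] := good_inverse_time gw uw.
  have /andP[x1 x2] := skorokhod_range sk r0.
  have bi : 0 < beta^-1 by rewrite invr_gt0.
  rewrite normrM normrN (gtr0_norm bi) mulrC ler_pdivrMr// mul1r.
  by rewrite ler_norml x1 x2.
exists D, Xi; split => // mu y mu0 y_root.
exact: (reflected_mean mu0 y_root DE XiE Dt Xi1).
Qed.

End reflected_identity.

(** * Equality of the laws *)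

(* At the two roots [y] of [mu y^2 - rate y - mu = 0] the identity gives two
   linear equations for the expectations of [expR (mu D)] and [expR (mu D) Xi]. *)
Lemma exponential_moment_of_roots {d} {T : measurableType d} {R : realType}
    (P : probability T R) (D Xi : {RV P >-> R}) (rate t mu : R) :
  0 < rate -> 0 < mu -> (forall w, `|D w| <= t) -> (forall w, `|Xi w| <= 1) ->
  (forall y, mu * y ^+ 2 - rate * y - mu = 0 ->
     \int[P]_w (expR (mu * D w + mu * y * t) * (1 - y * Xi w)) = 1) ->
  let root (s : R) := (rate + s * Num.sqrt (rate ^+ 2 + 4 * mu ^+ 2)) / (2 * mu) in
  \int[P]_w expR (mu * D w) =
    (root (-1) * expR (- (mu * root 1 * t)) - root 1 * expR (- (mu * root (-1) * t)))
      / (root (-1) - root 1).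
Proof.
move=> rate0 mu0 Dt Xi1 id root.
pose sq := Num.sqrt (rate ^+ 2 + 4 * mu ^+ 2).
have disc0 : 0 < rate ^+ 2 + 4 * mu ^+ 2 by rewrite addr_gt0 ?mulr_gt0 ?exprn_gt0.
have sq2 : sq ^+ 2 = rate ^+ 2 + 4 * mu ^+ 2 by rewrite sqr_sqrtr// ltW.
have sq0 : 0 < sq by rewrite sqrtr_gt0.
have mun0 : mu != 0 by rewrite gt_eqF.
have rootP s : s ^+ 2 = 1 -> mu * root s ^+ 2 - rate * root s - mu = 0.
  move=> s2; rewrite /root -/sq.
  have -> : mu * ((rate + s * sq) / (2 * mu)) ^+ 2 -
      rate * ((rate + s * sq) / (2 * mu)) - mu =
      (s ^+ 2 * sq ^+ 2 - (rate ^+ 2 + 4 * mu ^+ 2)) / (4 * mu) by field.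
  by rewrite s2 sq2 mul1r subrr mul0r.
have bE : bounded_measurable (fun w => expR (mu * D w)).
  split; first by apply: measurableT_comp => //; exact: measurable_funM.
  exists (expR (mu * t)) => w; rewrite ger0_norm ?expR_ge0// ler_expR.
  by rewrite ler_wpM2l ?(ltW mu0)//; exact: le_trans (ler_norm _) (Dt w).
have bX : bounded_measurable (fun w => expR (mu * D w) * Xi w).
  by apply: bounded_measurableM => //; split => //; exists 1.
have lin s : s ^+ 2 = 1 -> \int[P]_w expR (mu * D w) -
    root s * \int[P]_w (expR (mu * D w) * Xi w) = expR (- (mu * root s * t)).
  move=> s2; have := id _ (rootP s s2).
  rewrite (_ : (fun w => _) = (fun w => expR (mu * root s * t) *
      (expR (mu * D w) - root s * (expR (mu * D w) * Xi w)))); last first.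
    by apply/funext => w; rewrite expRD; ring.
  have bY : bounded_measurable (fun w => root s * (expR (mu * D w) * Xi w)).
    by apply: bounded_measurableM => //; exact: bounded_measurable_cst.
  rewrite RintegralZl//; last first.
    by apply: bounded_measurable_integrable; exact: bounded_measurableB.
  rewrite RintegralB//; do ?exact: bounded_measurable_integrable.
  rewrite RintegralZl//; last exact: bounded_measurable_integrable.
  move=> h; rewrite expRN; apply: (mulfI (lt0r_neq0 (expR_gt0 (mu * root s * t)))).
  by rewrite h divff// gt_eqF// expR_gt0.
have l1 := lin 1 (expr1n _ _).
have l2 : _ := lin (-1) (etrans (sqrrN _) (expr1n _ _)).
have ne : root (-1) - root 1 != 0.
  have -> : root (-1) - root 1 = - (sq / mu) by rewrite /root -/sq; field.
  by rewrite oppr_eq0 gt_eqF// divr_gt0.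
(* The unknown expectation of [expR (mu * D w) * Xi w] is eliminated between the two equations. *)
by apply: (mulIf ne); rewrite divfK// -l1 -l2; ring.
Qed.

(** The moment formula involves only [rate], [t] and [mu], so both variables have the same moments
    at positive integers. The exponent 0 lies outside that formula and amounts to the total mass. *)
Lemma distribution_eq_of_identity {d d'} {T : measurableType d}
    {T' : measurableType d'} {R : realType} (P : probability T R)
    (P' : probability T' R) (D Xi : {RV P >-> R}) (D' Xi' : {RV P' >-> R})
    (rate t : R) : 0 < rate ->
  (forall w, `|D w| <= t) -> (forall w, `|Xi w| <= 1) ->
  (forall w, `|D' w| <= t) -> (forall w, `|Xi' w| <= 1) ->
  (forall mu y, 0 < mu -> mu * y ^+ 2 - rate * y - mu = 0 ->
     \int[P]_w (expR (mu * D w + mu * y * t) * (1 - y * Xi w)) = 1) ->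
  (forall mu y, 0 < mu -> mu * y ^+ 2 - rate * y - mu = 0 ->
     \int[P']_w (expR (mu * D' w + mu * y * t) * (1 - y * Xi' w)) = 1) ->
  forall A : set R, measurable A -> distribution P D A = distribution P' D' A.
Proof.
move=> rate0 Dt Xi1 D't Xi'1 id id' A mA.
apply: (distribution_eq_exponential_moments Dt D't) => // -[|n].
  under eq_Rintegral do rewrite mul0r.
  under [RHS]eq_Rintegral do rewrite mul0r.
  by rewrite !Rintegral_prob_cst.
have n0 : (0 : R) < n.+1%:R by rewrite ltr0Sn.
rewrite (exponential_moment_of_roots rate0 n0 Dt Xi1 (fun y => id _ y n0)).
by rewrite (exponential_moment_of_roots rate0 n0 D't Xi'1 (fun y => id' _ y n0)).
Qed.

Theorem theorem3 (R : realType) (eta sigma : R)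
    (eta_gt0 : 0 < eta) (sigma_gt0 : 0 < sigma)
    (a b : R) (aE : a = - (eta / sigma)) (bE : b = eta / sigma)
    (d : measure_display) (T : measurableType d) (P : probability T R)
    (F : R -> set (set T)) (X B ga gb : R -> T -> R)
    (X_rbm : is_reflected_brownian P F a b X B ga gb)
    (X0_a : P [set w | X 0 w = a] = (1 / 2)%:E)
    (X0_b : P [set w | X 0 w = b] = (1 / 2)%:E)
    (d' : measure_display) (T' : measurableType d') (P' : probability T' R)
    (theta e : nat -> {RV P' >-> R})
    (tel : is_telegraph_data (sigma / eta) theta e)
    (t : R) (t_ge0 : 0 <= t) :
  eq_in_law P P'
    (fun w => let r := inverse_time (fun s => ga s w + gb s w) t in
              ga r w - gb r w)
    (fun w => telegraph (fun i => theta i w) (fun i => e i w) t).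
Proof.
subst a b.
have beta0 : 0 < eta / sigma by rewrite divr_gt0.
have rate0 : 0 < sigma / eta by rewrite divr_gt0.
have [D [Xi [DE Dt Xi1 id]]] := reflected_identity beta0 t_ge0 X_rbm X0_a X0_b.
have [Y [Xi' [YE Yt Xi'1 id']]] := telegraph_identity rate0 t_ge0 tel.
(* The inverse of the half-width [eta / sigma] is the rate [sigma / eta] of the waiting times, so
   both sides are governed by the same quadratic equation. *)
rewrite invf_div in id.
exists D, Y; split => //.
exact: distribution_eq_of_identity rate0 Dt Xi1 Yt Xi'1 id id'.
Qed.
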